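(* There is a function $\Delta(k)$ with $\Delta(k)=(\tfrac{1}{3}+o(1))k$ as $k\to\infty$ such that, for every sufficiently large natural number $k$ and each $\varepsilon>0$, one has $$J_{\frac{1}{2}k(k+1),k}(X)\ll X^{\frac{1}{2}k(k+1)+\Delta(k)+\varepsilon}.$$
   Context: For natural numbers $k,s$ and a large real number $X$, $J_{s,k}(X)$ denotes the number of integral solutions of the system $x_1^j+\ldots+x_s^j=y_1^j+\ldots+y_s^j$ $(1\le j\le k)$ with $1\le x_i,y_i\le X$ $(1\le i\le s)$. The implicit constant in $\ll$ may depend on $k$ and $\varepsilon$, but not on $X$. *)

(* Defs.v *)
From HB Require Import structures.
From mathcomp Require Import all_boot all_order all_algebra.
From mathcomp Require Import all_classical all_reals all_analysis.

Set Implicit Arguments.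
Unset Strict Implicit.
Unset Printing Implicit Defensive.

Import Order.TTheory GRing.Theory Num.Theory.
Import numFieldNormedType.Exports.

Local Open Scope ring_scope.

(* An integer x with 1 <= x <= X is a natural number that is at most
   [Num.truncn X], the integer part of X, so for X >= 0 the type
   ['I_(Num.truncn X).+1] misses no admissible value. *)
Definition vinogradov_vars (R : realType) (s : nat) (X : R) :=
  {ffun 'I_s -> 'I_(Num.truncn X).+1}.

Definition in_range (R : realType) (s : nat) (X : R)
    (x : vinogradov_vars s X) : bool :=
  [forall i, (1 <= x i)%N && ((x i)%:R <= X)].

(* The index j : 'I_k stands for the exponent j + 1 in {1, ..., k}. *)
Definition vinogradov_system (R : realType) (s k : nat) (X : R)
    (x y : vinogradov_vars s X) : bool :=
  [forall j : 'I_k,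
    (\sum_(i < s) x i ^ j.+1 == \sum_(i < s) y i ^ j.+1)%N].

Definition J (R : realType) (s k : nat) (X : R) : nat :=
  #|[set xy : vinogradov_vars s X * vinogradov_vars s X |
      [&& in_range xy.1, in_range xy.2 & vinogradov_system k xy.1 xy.2]]|.

(* Main.v *)
(** The full Vinogradov mean value theorem holds, so Delta k = k/3 leaves room to
    spare.  It is deduced from a p-adic l^2 decoupling inequality for the moment
    curve, with critical exponent 2s = k(k+1) and loss p^(eps N) for N levels of
    p-adic refinement, proved for one large prime p by a p-adic version of the
    bilinear argument of Guo, Li, Yung and Zorin-Kranich.  Instead of a curve one
    keeps only a family of functions that is multiplied by z^(g x) under suitable
    measure preserving permutations, for g close to every polynomial of degree at
    most k; this is stable under p-adic rescaling.

    For classes i mod p^a and j mod p^b with i, j distinct mod p, one bounds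
    sum |F_i|^(2 s_l) |F_j|^(2 (s_k - s_l)), where s_l = l(l+1)/2.  The polynomials
    that vanish to order k-l+1 at j fix |F_j| and restrict to a nondegenerate curve
    of degree l near i, so decoupling in degree l < k refines a to (k-l+1) b / l.
    Hoelder's inequality then passes from l to k-l (with the two classes exchanged)
    and to l-1.  After r rounds the bound has gained p^(-eps x b) with x unbounded
    in r, while the constants depend on finitely many scales only.  A broad-narrow
    argument turns this into decoupling by induction on N. *)

Require Import Defs.
From HB Require Import structures.
From mathcomp Require Import all_boot all_order all_algebra.
From mathcomp Require Import all_classical all_reals all_analysis.
From mathcomp Require Import fingroup perm cyclic separable cyclotomic.
From mathcomp Require Import complex ring lra zify.

Set Implicit Arguments.
Unset Strict Implicit.
Unset Printing Implicit Defensive.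

Import Order.TTheory GRing.Theory Num.Theory.
Import numFieldNormedType.Exports.
Import ComplexField.Normc.

Local Open Scope classical_set_scope.
Local Open Scope ring_scope.

(** * Sums over residue classes modulo powers of p *)

(* For i < p ^ a: the sum of h over the x < p ^ M that are congruent to i modulo p ^ a. *)
Definition gsum (V : nmodType) (p M a i : nat) (h : nat -> V) : V :=
  \sum_(y < p ^ (M - a)) h (i + p ^ a * y)%N.

Lemma sum_ord_mul (V : nmodType) (m n : nat) (h : nat -> V) :
  \sum_(z < m * n) h z = \sum_(t < m) \sum_(y < n) h (t + m * y)%N.
Proof.
rewrite exchange_big /=.
elim: n => [|n IH]; first by rewrite muln0 !big_ord0.
rewrite big_ord_recr /= -IH mulnSr big_split_ord /=; congr (_ + _).
by apply: eq_bigr => i _; rewrite addnC.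
Qed.

Lemma gsum_split (V : nmodType) (p M a d i : nat) (h : nat -> V) :
  (a + d <= M)%N ->
  gsum p M a i h = \sum_(t < p ^ d) gsum p M (a + d) (i + p ^ a * t) h.
Proof.
move=> adM; rewrite /gsum.
have -> : (M - a = d + (M - (a + d)))%N by lia.
rewrite expnD (sum_ord_mul _ _ (fun z => h (i + p ^ a * z)%N)).
apply: eq_bigr => t _; apply: eq_bigr => y _; congr h.
rewrite expnD; nia.
Qed.

Lemma gsum_split0 (V : nmodType) (p M d : nat) (h : nat -> V) :
  (d <= M)%N -> gsum p M 0 0 h = \sum_(t < p ^ d) gsum p M d t h.
Proof.
move=> dM; rewrite (@gsum_split _ p M 0 d) //.
by apply: eq_bigr => t _; rewrite !add0n expn0 mul1n.
Qed.

Lemma gsum_rescale (V : nmodType) (p M b a j i : nat) (h : nat -> V) :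
  (b <= M)%N ->
  gsum p (M - b) a i (fun y => h (j + p ^ b * y)%N) =
  gsum p M (b + a) (j + p ^ b * i) h.
Proof.
move=> bM; rewrite /gsum subnDA; apply: eq_bigr => y _; congr h.
rewrite expnD; nia.
Qed.

Lemma ltn_add_mul (m n i t : nat) : (i < m)%N -> (t < n)%N -> (i + m * t < m * n)%N.
Proof. nia. Qed.

Lemma Posz_exp (p n : nat) : (p ^ n)%N%:Z = p%:Z ^+ n.
Proof. by elim: n => // n IH; rewrite expnS exprS PoszM IH. Qed.

(** * Young's and Hoelder's inequalities with integral exponents *)

Lemma ler_exp_nneg (R : numDomainType) (n : nat) (x y : R) :
  0 <= x -> x <= y -> x ^+ n <= y ^+ n.
Proof. by move=> x0 xy; rewrite lerXn2r // nnegrE // (le_trans x0). Qed.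

(** The arithmetic-geometric mean inequality for one copy of x and n copies of y. *)
Lemma young_AGM (R : realFieldType) (n : nat) (z x y : R) :
  0 <= z -> 0 <= x -> 0 <= y -> z ^+ n.+1 <= x * y ^+ n ->
  z <= (x + n%:R * y) / n.+1%:R.
Proof.
move=> z0 x0 y0 H.
pose E (i : 'I_n.+1) := if i == ord0 then x else y.
have E0 i : i \in [pred _ : 'I_n.+1 | true] -> 0 <= E i by rewrite /E; case: ifP.
have /leifP := leif_AGM E0.
have -> : \prod_(i in [pred _ : 'I_n.+1 | true]) E i = x * y ^+ n.
  rewrite big_ord_recl /E eqxx; congr (_ * _).
  by rewrite big_const_ord iter_mulr_1.
have -> : \sum_(i in [pred _ : 'I_n.+1 | true]) E i = x + n%:R * y.
  rewrite big_ord_recl /E eqxx; congr (_ + _).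
  by rewrite big_const_ord iter_addr_0 mulr_natl.
have -> : #|[pred _ : 'I_n.+1 | true]| = n.+1 by rewrite -[RHS]card_ord; apply: eq_card.
move=> K; have {}K : z ^+ n.+1 <= ((x + n%:R * y) / n.+1%:R) ^+ n.+1.
  by apply: (le_trans H); move: K; case: ifP => _ => [/eqP -> //|/ltW].
by rewrite -(ler_pXn2r (ltn0Sn n)) // nnegrE divr_ge0 ?addr_ge0 ?mulr_ge0.
Qed.

(** Hoelder's inequality for the exponents 1 / n.+1 and n / n.+1, stated without roots. Dividing
    [X], [Y], [Z] by their bounds reduces it to Young's inequality at each point. *)
Lemma hoelder_sum_bound (R : realFieldType) (Om : finType) (w Z X Y : Om -> R)
    (n : nat) (al be G : R) :
  (forall o, 0 <= w o) -> (forall o, 0 <= Z o) -> (forall o, 0 <= X o) ->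
  (forall o, 0 <= Y o) -> (forall o, Z o ^+ n.+1 <= X o * Y o ^+ n) ->
  0 < al -> 0 < be -> 0 < G -> G ^+ n.+1 = al * be ^+ n ->
  \sum_o w o * X o <= al -> \sum_o w o * Y o <= be ->
  \sum_o w o * Z o <= G.
Proof.
move=> w0 Z0 X0 Y0 H a0 b0 G0 eG HX HY.
suff : \sum_o w o * Z o / G <= 1 by rewrite -mulr_suml ler_pdivrMr // mul1r.
have : \sum_o w o * Z o / G <= \sum_o w o * ((X o / al + n%:R * (Y o / be)) / n.+1%:R).
  apply: ler_sum => o _; rewrite -mulrA ler_wpM2l //.
  have Gi : 0 <= G^-1 by rewrite invr_ge0 ltW.
  have ai : 0 <= al^-1 by rewrite invr_ge0 ltW.
  have bi : 0 <= be^-1 by rewrite invr_ge0 ltW.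
  apply: young_AGM; rewrite ?mulr_ge0 //.
  rewrite !exprMn exprVn eG invfM mulrACA exprVn ler_wpM2r //.
  by rewrite mulr_ge0 // invr_ge0 exprn_ge0 // ltW.
move=> /le_trans; apply.
under eq_bigr do rewrite mulrA mulrDr.
rewrite -mulr_suml big_split /= ler_pdivrMr ?ltr0Sn // mul1r.
rewrite [n.+1%:R]mulrS; apply: lerD.
  under eq_bigr do rewrite mulrA.
  by rewrite -mulr_suml ler_pdivrMr // mul1r.
under eq_bigr do rewrite mulrCA (mulrA (w _)).
by rewrite -mulr_sumr -mulr_suml ler_piMr // ler_pdivrMr // mul1r.
Qed.

(** * The squared modulus and the broad-narrow dichotomy *)

Section SquareNorm.
Variable R : realType.
Local Notation C := (R[i]).

(** Real-valued, so that the even moments can be written with natural powers of it. *)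
Definition sqn (z : C) : R := normc z ^+ 2.

Lemma normc_ge0 (z : C) : 0 <= normc z.
Proof. by case: z => a b; rewrite sqrtr_ge0. Qed.

Lemma sqn_ge0 z : 0 <= sqn z.
Proof. exact: sqr_ge0. Qed.

Lemma sqnM x y : sqn (x * y) = sqn x * sqn y.
Proof. by rewrite /sqn normcM exprMn. Qed.

Lemma le_normc_sum (I : Type) (r : seq I) (P : pred I) (z : I -> C) :
  normc (\sum_(i <- r | P i) z i) <= \sum_(i <- r | P i) normc (z i).
Proof.
elim/big_rec2: _ => [|i y x _ H]; first by rewrite [normc _]normc0.
by apply: (le_trans (le_normcD _ _)); rewrite lerD2l.
Qed.

(** The sum is at most n times its largest term in modulus. *)
Lemma sqn_sum_le (n m : nat) (z : 'I_n -> C) :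
  (0 < n)%N ->
  sqn (\sum_(t < n) z t) ^+ m <= n%:R ^+ (2 * m) * \sum_(t < n) sqn (z t) ^+ m.
Proof.
case: n z => // n z _.
have [j _ jmax] := arg_maxP (fun i => normc (z i)) (isT : xpredT (@ord0 n)).
have H : normc (\sum_(t < n.+1) z t) <= n.+1%:R * normc (z j).
  apply: (le_trans (le_normc_sum _ _ _)).
  apply: (@le_trans _ _ (\sum_(t < n.+1) normc (z j))); first exact: ler_sum.
  by rewrite sumr_const card_ord mulr_natl.
have Hs : sqn (\sum_(t < n.+1) z t) <= n.+1%:R ^+ 2 * sqn (z j).
  by rewrite /sqn -exprMn ler_exp_nneg // normc_ge0.
apply: (@le_trans _ _ ((n.+1%:R ^+ 2 * sqn (z j)) ^+ m)).
  by rewrite ler_exp_nneg // sqn_ge0.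
rewrite exprMn -exprM ler_wpM2l ?exprn_ge0 //.
by rewrite (bigD1 j) //= lerDl sumr_ge0 // => i _; rewrite exprn_ge0 // sqn_ge0.
Qed.

(** Let z_j be the largest term and z_i the second largest. Either the sum is at most 2 |z_j|, or
    the bound |z_j| + n |z_i| forces it to be at most 2 n |z_i|. In the second case r of the factors
    |z_i| ^ 2 may be raised to |z_j| ^ 2. *)
Lemma broad_narrow (n m r : nat) (z : 'I_n -> C) :
  (1 < n)%N -> (r <= m)%N ->
  sqn (\sum_(t < n) z t) ^+ m <=
   4 ^+ m * (\sum_(t < n) sqn (z t) ^+ m) +
   (4 * n%:R ^+ 2) ^+ m * (\sum_(i < n) \sum_(j < n | j != i)
        sqn (z i) ^+ r * sqn (z j) ^+ (m - r)).
Proof.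
case: n z => [|[|n]] // z _ rm.
set N := n.+2.
have [j _ jmax] := arg_maxP (fun i => normc (z i)) (isT : xpredT (@ord0 n.+1)).
have [i ij imax] : exists2 i : 'I_N, i != j & forall t, t != j -> normc (z t) <= normc (z i).
  have h : lift j (@ord0 n) != j by rewrite eq_sym neq_lift.
  have [i ij imax] := arg_maxP (fun i => normc (z i)) (h : [pred t | t != j] _).
  by exists i.
have nn x : 0 <= normc (z x) by exact: normc_ge0.
have sn x k : 0 <= sqn (z x) ^+ k by rewrite exprn_ge0 // sqn_ge0.
have H : normc (\sum_(t < N) z t) <= normc (z j) + N%:R * normc (z i).
  apply: (le_trans (le_normc_sum _ _ _)); rewrite (bigD1 j) //= lerD2l.
  apply: (@le_trans _ _ (\sum_(t < N | t != j) normc (z i))); first exact: ler_sum.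
  apply: (@le_trans _ _ (\sum_(t < N) normc (z i))).
    by rewrite [leRHS](bigD1 j) //= lerDr.
  by rewrite sumr_const card_ord mulr_natl.
have S1 : 0 <= \sum_(t < N) sqn (z t) ^+ m by apply: sumr_ge0 => t _.
have S2 : 0 <= \sum_(i < N) \sum_(j < N | j != i) sqn (z i) ^+ r * sqn (z j) ^+ (m - r).
  by apply: sumr_ge0 => t _; apply: sumr_ge0 => u _; rewrite mulr_ge0.
have [le2|gt2] := leP (normc (\sum_(t < N) z t)) (2 * normc (z j)).
  apply: ler_wpDr; first by rewrite ?(mulr_ge0, exprn_ge0).
  have : sqn (\sum_(t < N) z t) <= 4 * sqn (z j).
    have -> : 4 = 2 ^+ 2 :> R by rewrite -natrX.
    by rewrite /sqn -exprMn ler_exp_nneg // normc_ge0.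
  move=> K; apply: (@le_trans _ _ ((4 * sqn (z j)) ^+ m)).
    by rewrite ler_exp_nneg // sqn_ge0.
  by rewrite exprMn ler_wpM2l ?exprn_ge0 // (bigD1 j) //= lerDl sumr_ge0.
apply: ler_wpDl; first by rewrite mulr_ge0 // exprn_ge0.
have K : sqn (\sum_(t < N) z t) <= 4 * N%:R ^+ 2 * sqn (z i).
  have -> : 4 * N%:R ^+ 2 = (2 * N%:R) ^+ 2 :> R by rewrite exprMn -(natrX _ 2 2).
  rewrite /sqn -exprMn ler_exp_nneg ?normc_ge0 //.
  lra.
apply: (@le_trans _ _ ((4 * N%:R ^+ 2 * sqn (z i)) ^+ m)).
  by rewrite ler_exp_nneg // sqn_ge0.
rewrite exprMn ler_wpM2l ?exprn_ge0 ?mulr_ge0 ?exprn_ge0 //.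
rewrite (bigD1 j) //= (bigD1 i) //=.
apply: (@le_trans _ _ (sqn (z j) ^+ r * sqn (z i) ^+ (m - r))).
  rewrite -{1}(subnKC rm) exprD ler_wpM2r // ler_exp_nneg ?sqn_ge0 //.
  by rewrite /sqn ler_exp_nneg //; apply: jmax.
rewrite -addrA lerDl addr_ge0 ?sumr_ge0 // => [t _|t _]; first by rewrite mulr_ge0.
by apply: sumr_ge0 => u _; rewrite mulr_ge0.
Qed.

End SquareNorm.

(** * Phase symmetries and the decoupling inequality *)

Lemma prim_exprz_eq1 (F : fieldType) (n : nat) (z : F) (m : int) :
  n.-primitive_root z -> (z ^ m == 1) = (n%:Z %| m)%Z.
Proof.
move=> pz; case: (intP m) => [|k|k]; first by rewrite expr0z eqxx dvdz0.
  by rewrite -exprnP -(prim_order_dvd pz) dvdzE.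
by rewrite -invr_expz -exprnP -[1 in LHS]invr1 (inj_eq (@invr_inj _)) -(prim_order_dvd pz) dvdzE abszN.
Qed.

Lemma sum_exp_le (R : realDomainType) (n s : nat) (c : 'I_n -> R) :
  (0 < s)%N -> (forall i, 0 <= c i) ->
  \sum_i c i ^+ s <= (\sum_i c i) ^+ s.
Proof.
case: s => // s _ c0; rewrite exprS mulr_suml; apply: ler_sum => i _.
rewrite exprS ler_wpM2l // ler_exp_nneg //.
by rewrite (bigD1 i) //= lerDl sumr_ge0.
Qed.

Lemma gsum_id (V : nmodType) (p N i : nat) (h : nat -> V) : gsum p N N i h = h i.
Proof. by rewrite /gsum subnn expn0 big_ord1 muln0 addn0. Qed.

Lemma gsum_gt0 (R : numDomainType) (p N a i : nat) (c : nat -> R) :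
  (0 < p)%N -> (forall x, 0 < c x) -> 0 < gsum p N a i c.
Proof.
move=> p0 c0; rewrite /gsum -(prednK (_ : 0 < p ^ (N - a))%N) ?expn_gt0 ?p0 //.
by rewrite big_ord_recl ltr_wpDr // sumr_ge0 // => j _; rewrite ltW.
Qed.

Section Systems.
Variable R : realType.
Local Notation C := (R[i]).
Implicit Types (Om : finType) (p N M k : nat) (z : C).

(** As [sqn] is already a square, [sqn F ^+ tri k] is |F| to the critical exponent k (k + 1). *)
Definition tri k := (\sum_(i < k.+1) i)%N.

Lemma triS k : tri k.+1 = (tri k + k.+1)%N.
Proof. by rewrite /tri big_ord_recr. Qed.

Lemma tri0 : tri 0 = 0%N.
Proof. by rewrite /tri big_ord1. Qed.

Lemma tri_gt0 k : (0 < k)%N -> (0 < tri k)%N.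
Proof. by case: k => // k _; rewrite triS addnS. Qed.

(* Models a translation of the physical space: it multiplies f x by the character
   value z ^ (g x), up to a unimodular factor that does not depend on x. *)
Definition phase_sym Om (w : Om -> R) (f : nat -> Om -> C) z (g : {poly int}) :=
  exists (T : {perm Om}) (u : C), [/\ sqn u = 1, forall o, w (T o) = w o &
    forall x o, f x (T o) = u * z ^ g.[x%:Z] * f x o].

(* The errors e are arbitrary.  The factor ('X - xi) ^+ k.+1 makes the condition
   invariant under x = j + p ^ b * y, the factor p keeps transversality modulo p. *)
Definition nondegenerate k p Om (w : Om -> R) (f : nat -> Om -> C) z :=
  forall xi j : nat, (j <= k)%N -> exists e : {poly int},
    phase_sym w f z (('X - xi%:Z%:P) ^+ j + p%:Z%:P * ('X - xi%:Z%:P) ^+ k.+1 * e).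

(** The order of [z] makes the phase (x - J) ^ k trivial on the class of J modulo p ^ N. The number
    [c J] bounds the square of the critical norm of the piece J; it is positive so that one may
    divide by it. *)
Definition admissible k p N M Om (w : Om -> R) (f : nat -> Om -> C) z (c : nat -> R) :=
  [/\ (p ^ (k * N)).-primitive_root z, forall o, 0 <= w o,
      nondegenerate k p w f z, forall J, 0 < c J &
      forall J, (J < p ^ N)%N ->
        \sum_o w o * sqn (gsum p M N J (f^~ o)) ^+ tri k <= c J ^+ tri k].

(* The functions live on [0, p ^ M) and may be finer than the classes modulo p ^ N
   into which they are decoupled; gsum p N 0 0 c is the sum of all c J. *)
Definition decoupling k p N (D : R) :=
  forall Om w f z c M, (N <= M)%N -> @admissible k p N M Om w f z c ->
    \sum_o w o * sqn (gsum p M 0 0 (f^~ o)) ^+ tri k <= D * gsum p N 0 0 c ^+ tri k.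

Lemma sqn_conj (x : C) : (sqn x)%:C%C = x * x^*%C.
Proof.
case: x => a b; rewrite /sqn /normc sqr_sqrtr ?addr_ge0 ?sqr_ge0 //.
by apply/eqP; rewrite eq_complex /= -!expr2; apply/andP; split; apply/eqP; ring.
Qed.

Lemma sqn1 : sqn (1 : C) = 1.
Proof. by rewrite /sqn [normc _]normc1 expr1n. Qed.

Lemma sqn_eq0 (x : C) : (sqn x == 0) = (x == 0).
Proof.
apply/eqP/eqP => [/eqP|->]; last by rewrite /sqn [normc _]normc0 expr0n.
by rewrite expf_eq0 /= => /eqP /eq0_normc.
Qed.

Lemma sqnX (x : C) n : sqn (x ^+ n) = sqn x ^+ n.
Proof. by elim: n => [|n IH]; rewrite ?sqn1 // !exprS sqnM IH. Qed.

Lemma sqnV (x : C) : sqn x^-1 = (sqn x)^-1.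
Proof. by rewrite /sqn normcV exprVn. Qed.

Lemma sqn_unity z q : (0 < q)%N -> z ^+ q = 1 -> sqn z = 1.
Proof.
move=> q0 zq; apply/eqP; rewrite -(pexpr_eq1 q0) ?sqn_ge0 //.
by rewrite -sqnX zq sqn1.
Qed.

Lemma sqn_exprz z (m : int) : sqn z = 1 -> sqn (z ^ m) = 1.
Proof.
by move=> z1; case: m => n; rewrite /exprz ?sqnV sqnX z1 expr1n ?invr1.
Qed.

Section Group.
Variables (Om : finType) (w : Om -> R) (f : nat -> Om -> C) (z : C).
Hypothesis z1 : sqn z = 1.

Let z0 : z != 0.
Proof. by rewrite -sqn_eq0 z1 oner_neq0. Qed.

Lemma phase_symC (c : int) : phase_sym w f z c%:P.
Proof.
exists 1%g, (z ^ (- c)); split=> [|o|x o]; rewrite ?perm1 ?sqn_exprz //.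
by rewrite hornerC -expfzDr // addNr expr0z mul1r.
Qed.

(** Composing permutations adds phases and inverting them negates phases, so the realized
    polynomials form an additive group that contains the constants. *)
Lemma phase_symD g h :
  phase_sym w f z g -> phase_sym w f z h -> phase_sym w f z (g + h).
Proof.
move=> [T [u [u1 wT fT]]] [T' [u' [u'1 wT' fT']]].
exists (T * T')%g, (u * u'); split=> [|o|x o]; first by rewrite sqnM u1 u'1 mulr1.
  by rewrite permM wT' wT.
by rewrite permM fT' fT hornerD expfzDr //; ring.
Qed.

Lemma phase_symN g : phase_sym w f z g -> phase_sym w f z (- g).
Proof.
move=> [T [u [u1 wT fT]]].
have u0 : u != 0 by rewrite -sqn_eq0 u1 oner_neq0.
exists (T^-1)%g, u^-1; split=> [|o|x o]; first by rewrite sqnV u1 invr1.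
  by rewrite -[in RHS](permKV T o) wT.
rewrite -[in RHS](permKV T o) fT hornerN -invr_expz.
have zg : z ^ g.[x%:Z] != 0 by rewrite expfz_neq0.
by field; rewrite zg u0.
Qed.

Lemma phase_symZ (c : int) g : phase_sym w f z g -> phase_sym w f z (c%:P * g).
Proof.
move=> sg.
have H n : phase_sym w f z (n%:Z%:P * g).
  elim: n => [|n IH]; first by rewrite mul0r -polyC0; apply: phase_symC.
  by rewrite intS polyCD mulrDl mul1r; apply: phase_symD.
case: (intP c) => [|n|n]; [exact: H|exact: H|].
by rewrite polyCN mulNr; apply: phase_symN; apply: H.
Qed.

Lemma phase_sym_sum n (c : 'I_n -> int) (g : 'I_n -> {poly int}) :
  (forall i, phase_sym w f z (g i)) ->
  phase_sym w f z (\sum_i (c i)%:P * g i).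
Proof.
move=> sg; elim/big_ind: _ => [|x y|i _]; first by rewrite -polyC0; apply: phase_symC.
  exact: phase_symD.
exact: phase_symZ.
Qed.

End Group.

Lemma exprz_congr z q (a b : int) :
  z != 0 -> z ^+ q = 1 -> (exists t, a = b + q%:Z * t) -> z ^ a = z ^ b.
Proof.
move=> z0 zq [t ->]; rewrite expfzDr // -exprz_exp.
by rewrite -exprnP zq exp1rz mulr1.
Qed.

End Systems.

(** * Rescaling to a residue class, the trivial bound and degree 1 *)

Section Rescale.
Variable R : realType.
Local Notation C := (R[i]).

Lemma prim_root_exp_sub (z : C) p k N b : (0 < p)%N -> (b <= N)%N ->
  (p ^ (k * N)).-primitive_root z ->
  (p ^ (k * (N - b))).-primitive_root (z ^+ (p ^ (k * b))).
Proof.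
move=> p0 bN pz.
have e : (p ^ (k * N) = p ^ (k * b) * p ^ (k * (N - b)))%N.
  by rewrite -expnD -mulnDr subnKC.
have := dvdn_prim_root pz (_ : (p ^ (k * (N - b)) %| p ^ (k * N))%N).
rewrite e mulnK ?expn_gt0 ?p0 //; apply.
exact: dvdn_mull.
Qed.

(** Under x = j + p ^ b y, the i-th power of x minus a centre in the class gains p ^ (i b).
    Multiplying the symmetry by p ^ ((k - i) b) completes this to p ^ (k b), which is absorbed in
    the new root of unity. *)
Lemma admissible_rescale k p N M (Om : finType) (w : Om -> R) f (z : C) c b j :
  (0 < p)%N -> (b <= N)%N -> (N <= M)%N -> (j < p ^ b)%N ->
  admissible k p N M w f z c ->
  admissible k p (N - b) (M - b) w (fun y => f (j + p ^ b * y)%N)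
     (z ^+ (p ^ (k * b))) (fun y => c (j + p ^ b * y)%N).
Proof.
move=> p0 bN NM jb [pz w0 nd c0 H]; split=> //.
- exact: prim_root_exp_sub.
- move=> xi i ik; have [e [T [u [u1 wT fT]]]] := nd (j + p ^ b * xi)%N i ik.
  (* The error gains p ^ ((k + 1) b) from its own power and p ^ ((k - i) b) from the multiplication;
     p ^ (k b) of this goes into the root of unity. *)
  exists ((p ^ ((k - i) * b + b))%N%:Z%:P * (e \Po (j%:Z%:P + (p ^ b)%N%:Z%:P * 'X))).
  have z1 : sqn z = 1 by apply: sqn_unity (prim_expr_order pz); rewrite expn_gt0 p0.
  have nd' := phase_symZ z1 (p ^ ((k - i) * b))%N%:Z (ex_intro _ T (ex_intro _ u (And3 u1 wT fT))).
  have [T' [u' [u'1 wT' fT']]] := nd'.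
  exists T', u'; split=> // y o; rewrite fT'; congr (_ * _ * _).
  rewrite [X in _ = X ^ _]exprnP exprz_exp; congr (_ ^ _).
  have -> : ((p ^ (k * b))%N = p ^ ((k - i) * b) * (p ^ b) ^ i)%N.
    by rewrite -expnM -expnD; congr (_ ^ _)%N; nia.
  rewrite expnD (_ : p ^ ((k - i) * b) = (p ^ b) ^ (k - i))%N; last by rewrite -expnM mulnC.
  move: (p ^ b)%N => P; rewrite !(PoszM, PoszD).
  rewrite !(hornerD, hornerM, hornerC, hornerX, hornerN, horner_exp, horner_comp).
  rewrite !Posz_exp.
  have -> : j%:Z + P%:Z * y%:Z - (j%:Z + P%:Z * xi%:Z) = P%:Z * (y%:Z - xi%:Z) by ring.
  have Pk : P%:Z ^+ k = P%:Z ^+ (k - i) * P%:Z ^+ i by rewrite -exprD subnK.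
  rewrite /= !exprMn (exprS P%:Z k) Pk; set E := e.[_].
  by ring.
- move=> J JN.
  have jJ : (j + p ^ b * J < p ^ N)%N.
    by rewrite -(subnKC bN) expnD ltn_add_mul.
  have -> : \sum_o w o * sqn (gsum p (M - b) (N - b) J
      ((fun y => f (j + p ^ b * y)%N)^~ o)) ^+ tri k =
    \sum_o w o * sqn (gsum p M N (j + p ^ b * J) (f^~ o)) ^+ tri k.
    apply: eq_bigr => o _.
    by rewrite (gsum_rescale _ _ _ _ (f^~ o) (leq_trans bN NM)) subnKC.
  exact: H.
Qed.

Lemma decoupling_rescale k p N D b j M (Om : finType) (w : Om -> R) f (z : C) c :
  (0 < p)%N -> (b <= N)%N -> (N <= M)%N -> (j < p ^ b)%N ->
  decoupling k p (N - b) D ->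
  admissible k p N M w f z c ->
  \sum_o w o * sqn (gsum p M b j (f^~ o)) ^+ tri k <= D * gsum p N b j c ^+ tri k.
Proof.
move=> p0 bN NM jb dec adm.
have := dec _ _ _ _ _ (M - b)%N (leq_sub2r _ NM) (admissible_rescale p0 bN NM jb adm).
rewrite (gsum_rescale _ _ _ _ c bN) addn0 muln0 addn0 => /(le_trans _); apply.
apply: ler_sum => o _.
by rewrite (gsum_rescale _ _ _ _ (f^~ o) (leq_trans bN NM)) addn0 muln0 addn0.
Qed.

(** The triangle inequality over the p ^ N classes. Its cost grows with N, but it starts the
    induction on N. *)
Lemma decoupling_trivial k p N : (0 < p)%N -> (0 < k)%N ->
  decoupling k p N (p%:R ^+ (2 * N * tri k) : R).
Proof.
move=> p0 k0 Om w f z c M NM [pz w0 nd c0 H].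
have gs : gsum p N 0 0 c = \sum_(t < p ^ N) c t.
  by rewrite (gsum_split0 _ _ (leqnn N)); apply: eq_bigr => t _; rewrite gsum_id.
apply: (@le_trans _ _ (\sum_o \sum_(t < p ^ N) p%:R ^+ (2 * N * tri k) *
     (w o * sqn (gsum p M N t (f^~ o)) ^+ tri k))).
  apply: ler_sum => o _; rewrite (gsum_split0 _ _ NM) -mulr_sumr -mulr_sumr mulrCA ler_wpM2l //.
  apply: le_trans (sqn_sum_le _ _ _) _; first by rewrite expn_gt0 p0.
  by rewrite natrX -exprM mulnA (mulnC N 2).
rewrite exchange_big /=; under eq_bigr do rewrite -mulr_sumr.
rewrite -mulr_sumr ler_wpM2l ?exprn_ge0 //.
apply: (@le_trans _ _ (\sum_(t < p ^ N) c t ^+ tri k)).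
  by apply: ler_sum => t _; apply: H.
by rewrite gs sum_exp_le ?tri_gt0 // => i; apply: ltW.
Qed.

(** The degree 1 symmetry centred at y has phase 0 at y and d (1 + p d E) at x, where d = x - y. The
    second factor is prime to p, so the sum is multiplied by a root of unity other than 1 and must
    vanish. *)
Lemma sum_shift_eq0 (Om : finType) (w : Om -> R) (f : nat -> Om -> C) z p N (x y : nat) :
  (1 < p)%N ->
  (p ^ N).-primitive_root z -> nondegenerate 1 p w f z ->
  ~~ ((p ^ N)%N%:Z %| x%:Z - y%:Z)%Z ->
  \sum_o (w o)%:C%C * f x o * (f y o)^*%C = 0.
Proof.
move=> p1 pz nd xy.
have [e [T [u [u1 wT fT]]]] := nd y 1%N isT.
set g := _ + _ in fT; set S := \sum_o _.
have gy : g.[y%:Z] = 0.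
  rewrite /g !(hornerD, hornerM, hornerC, hornerX, hornerN, horner_exp) subrr /=.
  by rewrite mulr0 mul0r addr0.
have : S = z ^ g.[x%:Z] * S.
  rewrite {1}/S (reindex_inj (@perm_inj _ T)) /= mulr_sumr; apply: eq_bigr => o _.
  rewrite wT !fT gy expr0z mulr1 !rmorphM /=.
  have := sqn_conj u; rewrite u1 => uu.
  transitivity ((u * u^*%C) * (z ^ g.[x%:Z] * ((w o)%:C%C * f x o * (f y o)^*%C))).
    by move: (z ^ _) (f x o) (f y o)^*%C u^*%C (w o)%:C%C => *; ring.
  by rewrite -uu mul1r.
move/eqP; rewrite -subr_eq0 -[X in X - _]mul1r -mulrBl mulf_eq0 => /orP[|/eqP //].
rewrite subr_eq0 eq_sym (prim_exprz_eq1 _ pz) => h; case/negP: xy.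
move: h; rewrite /g !(hornerD, hornerM, hornerC, hornerX, hornerN, horner_exp) -mulrA => h.
move: h; set d := x%:Z - y%:Z; set E := e.[_].
have -> : d + p%:Z * (d ^+ 2 * E) = d * (1 + p%:Z * (d * E)) by ring.
rewrite Gauss_dvdzl // Posz_exp.
apply: coprimezXl; apply/coprimezP; exists (- (d * E), 1) => /=; ring.
Qed.

(** In degree 1 the critical exponent is 2, and expanding the square leaves only the diagonal terms
    by orthogonality. *)
Lemma decoupling1 p N : prime p -> decoupling 1 p N (1 : R).
Proof.
move=> pp Om w f z c M NM [pz w0 nd c0 H].
rewrite mul1n in pz.
have p0 := prime_gt0 pp.
have gs : gsum p N 0 0 c = \sum_(t < p ^ N) c t.
  by rewrite (gsum_split0 _ _ (leqnn N)); apply: eq_bigr => t _; rewrite gsum_id.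
have tri1 : tri 1 = 1%N by rewrite triS tri0.
rewrite mul1r gs tri1 !expr1.
apply: (@le_trans _ _ (\sum_(t < p ^ N) \sum_o w o * sqn (gsum p M N t (f^~ o)))); last first.
  by apply: ler_sum => t _; have := H t (ltn_ord t); rewrite tri1 expr1.
under eq_bigr do rewrite expr1.
rewrite exchange_big /= le_eqVlt; apply/orP; left; apply/eqP.
apply: (@complexI R); rewrite !rmorph_sum /=.
have orth x y : ~~ ((p ^ N)%N%:Z %| x%:Z - y%:Z)%Z ->
  \sum_o (w o)%:C%C * f x o * (f y o)^*%C = 0.
  exact: (sum_shift_eq0 (prime_gt1 pp) pz nd).
transitivity (\sum_(t < p ^ N) \sum_(t' < p ^ N) \sum_o
   (w o)%:C%C * gsum p M N t (f^~ o) * (gsum p M N t' (f^~ o))^*%C).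
  under [RHS]eq_bigr do rewrite exchange_big /=.
  rewrite [RHS]exchange_big /=; apply: eq_bigr => o _.
  rewrite rmorphM /= sqn_conj (gsum_split0 _ _ NM).
  rewrite rmorph_sum /= mulr_suml mulr_sumr; apply: eq_bigr => t _.
  by rewrite mulrA mulr_sumr.
under [RHS]eq_bigr do rewrite rmorph_sum /=.
rewrite [RHS]exchange_big /=; apply: eq_bigr => t _.
rewrite (bigD1 t) //= [X in _ + X]big1 ?addr0 => [|t' tt'].
  by apply: eq_bigr => o _; rewrite rmorphM /= sqn_conj mulrA.
rewrite /gsum.
transitivity (\sum_(y < p ^ (M - N)) \sum_(y' < p ^ (M - N)) \sum_o
   (w o)%:C%C * f (t + p ^ N * y)%N o * (f (t' + p ^ N * y')%N o)^*%C).
  under [RHS]eq_bigr do rewrite exchange_big /=.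
  rewrite [RHS]exchange_big /=; apply: eq_bigr => o _.
  rewrite rmorph_sum /= -mulrA mulr_suml mulr_sumr; apply: eq_bigr => y _.
  by rewrite mulrA mulr_sumr.
apply: big1 => y _; apply: big1 => y' _; apply: orth.
apply: contra tt' => /dvdzP [q e]; apply/eqP/val_inj => /=.
have := ltn_ord t; have := ltn_ord t'; rewrite !PoszD !PoszM in e => l1 l2.
suff : (q - y%:Z + y'%:Z = 0)%R by nia.
nia.
Qed.

End Rescale.

(** * Prescribing jets by combinations of powers centred elsewhere *)

Section Jets.

(** The adjugate inverts [A] up to its determinant, which a Bezout coefficient turns into 1 modulo
    q. *)
Lemma mx_solve_mod (l q : nat) (A : 'M[int]_l) (v : 'rV[int]_l) :
  coprimez (\det A) q -> exists r v' : 'rV[int]_l, r *m A = v + q%:Z *: v'.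
Proof.
move=> /coprimezP [[a b] /= ab].
exists (a *: (v *m \adj A)), (- b *: v).
rewrite -scalemxAl -mulmxA mul_adj_mx mul_mx_scalar !scalerA -[X in X + _]scale1r -scalerDl.
by congr (_ *: _); rewrite -ab; ring.
Qed.

Lemma natr_Fp_neq0 (p m : nat) : prime p -> (0 < m < p)%N -> (m%:R : 'F_p) != 0.
Proof.
move=> pp /andP [m0 mp].
by rewrite -(dvdn_pcharf (pchar_Fp pp)) gtnNdvd.
Qed.

Lemma intr_Fp_eq0 (p : nat) (m : int) : prime p -> ((m%:~R : 'F_p) == 0) = (p%:Z %| m)%Z.
Proof.
move=> pp; have H (n : nat) : ((n%:Z%:~R : 'F_p) == 0) = (p%:Z %| n%:Z)%Z.
  by rewrite dvdzE -[RHS]/(p %| n)%N (dvdn_pcharf (pchar_Fp pp)).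
by case: (intP m) => [|n|n]; rewrite ?rmorphN ?oppr_eq0 ?rpredN; [exact: (H 0)|exact: H|exact: H].
Qed.

(* The derivative of the combination is divisible by 'X ^ l, and it factors as the
   unit ('X + d) ^ (k - l) times a polynomial of degree < l. *)
Lemma jets_free (p k l : nat) (d : 'F_p) (v : 'I_l -> 'F_p) :
  prime p -> (k < p)%N -> (l <= k)%N -> d != 0 ->
  (forall t : 'I_l, (\sum_m v m *: ('X + d%:P) ^+ (k - l + m).+1)`_t.+1 = 0) ->
  forall m, v m = 0.
Proof.
move=> pp kp lk d0; set q := \sum_m _ => Hq.
pose s : {poly 'F_p} := \sum_m (v m * (k - l + m).+1%:R) *: ('X + d%:P) ^+ m.
have q's : q^`() = ('X + d%:P) ^+ (k - l) * s.
  rewrite /q raddf_sum mulr_sumr; apply: eq_bigr => m _.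
  rewrite /= derivZ deriv_exp derivD derivX derivC addr0 mul1r /=.
  by rewrite -scalerAr -exprD -scaler_nat scalerA.
have dv : 'X^l %| q^`().
  apply/dvdpP; exists (drop_poly l q^`()).
  rewrite -[LHS](poly_take_drop l) [X in X + _](_ : _ = 0) ?add0r //.
  apply/polyP => i; rewrite coef_take_poly coef0; case: ltnP => // il.
  by rewrite coef_deriv (Hq (Ordinal il)) mul0rn.
pose P : {poly 'F_p} := \sum_m (v m * (k - l + m).+1%:R) *: 'X^m.
have szP : (size P <= l)%N.
  apply/leq_sizeP => j lj; rewrite coef_sum big1 // => m _.
  by rewrite coefZ coefXn gtn_eqF ?mulr0 // (leq_trans (ltn_ord m)).
have sP : s = P \Po ('X + d%:P).
  rewrite /s /P raddf_sum; apply: eq_bigr => m _ /=.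
  by rewrite comp_polyZ comp_Xn_poly.
have sz2 : size ('X + d%:P) = 2 by rewrite size_XaddC.
have s0 : s = 0.
  apply/eqP; apply: contraTT dv => s0; rewrite q's.
  (* Since d is nonzero, 'X ^ l is prime to the power of 'X + d, so it would divide [s], whose
     degree is less than l. *)
  rewrite Gauss_dvdpr; last first.
    rewrite coprimep_expl // coprimep_expr //.
    by rewrite -[d]opprK polyCN coprimep_XsubC rootX oppr_eq0.
  apply/negP => /(dvdp_leq s0).
  by rewrite size_polyXn ltnNge sP size_comp_poly2 // szP.
have P0 : P = 0.
  by apply/eqP; rewrite -size_poly_eq0 -(size_comp_poly2 P sz2) -sP s0 size_poly0.
move=> m; have /(congr1 (fun r : {poly 'F_p} => r`_m)) := P0.
rewrite coef0 coef_sum (bigD1 m) //= coefZ coefXn eqxx mulr1 big1 ?addr0 => [|j jm].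
  (* The factors produced by differentiation lie between 1 and k, and k < p makes them invertible
     modulo p. *)
  move/eqP; rewrite mulf_eq0 (negPf (natr_Fp_neq0 pp _)) ?orbF => [/eqP //|].
  by have := ltn_ord m; lia.
by rewrite coefZ coefXn (inj_eq val_inj) eq_sym (negPf jm) mulr0.
Qed.

(* Combinations of the approximate powers of 'X - eta of order k - l + 1, ..., k
   realize, modulo p ^ n, every prescribed l-jet at xi up to its constant term. *)
Lemma jets_elim (p k l n : nat) (xi eta : int) (e : 'I_l -> {poly int}) (j : 'I_l) :
  prime p -> (k < p)%N -> (l <= k)%N -> ~~ (p%:Z %| xi - eta)%Z ->
  exists (r : 'I_l -> int) (c : int) (E E' : {poly int}),
    \sum_m (r m)%:P * (('X - eta%:P) ^+ (k - l + m).+1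
                         + p%:Z%:P * ('X - eta%:P) ^+ k.+1 * e m) + c%:P =
    ('X - xi%:P) ^+ j.+1 + ('X - xi%:P) ^+ l.+1 * E + (p ^ n)%N%:Z%:P * E'.
Proof.
move=> pp kp lk xe.
pose G (m : 'I_l) := ('X - eta%:P) ^+ (k - l + m).+1 + p%:Z%:P * ('X - eta%:P) ^+ k.+1 * e m.
pose H (m : 'I_l) := G m \Po ('X + xi%:P).
(* Row m holds the Taylor coefficients at xi, of orders 1 to l, of the m-th approximate power. *)
pose A : 'M[int]_l := \matrix_(m, t) (H m)`_t.+1.
have HF (m : 'I_l) : map_poly (intr : int -> 'F_p) (H m) = ('X + ((xi - eta)%:~R)%:P) ^+ (k - l + m).+1.
  rewrite /H map_comp_poly /G !rmorphD !rmorphM !rmorphXn /= !rmorphB /= !map_polyX !map_polyC /=.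
  have -> : p%:Z%:~R = 0 :> 'F_p by apply/eqP; rewrite intr_Fp_eq0 // dvdzz.
  rewrite !comp_polyC !comp_polyX polyC0 !mul0r addr0.
  by rewrite rmorphN /= polyCN addrA.
(* Modulo p the errors disappear, and a vanishing determinant would contradict the independence of
   the jets. *)
have dA : coprimez (\det A) (p ^ n)%N.
  rewrite Posz_exp coprimezXr // coprimezE coprime_sym prime_coprime //.
  rewrite -[(_ %| _)%N]/(p%:Z %| \det A)%Z -intr_Fp_eq0 // -det_map_mx.
  apply/det0P => -[v /negP v0 vA]; apply: v0; apply/eqP/rowP => m; rewrite mxE.
  apply: (jets_free pp kp lk (d := (xi - eta)%:~R)) m => [|t].
    by rewrite intr_Fp_eq0.
  move/rowP/(_ t): vA; rewrite !mxE => vAt; rewrite -[RHS]vAt.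
  rewrite coef_sum; apply: eq_bigr => m _.
  by rewrite coefZ -HF coef_map !mxE.
have [r [v' rA]] := mx_solve_mod (delta_mx 0 j) dA.
pose Q := \sum_m (r 0 m)%:P * H m.
pose V : {poly int} := \sum_(t < l) v' 0 t *: 'X^(t.+1).
(* What remains after removing the constant term, the prescribed jet and the multiple of p ^ n has
   no coefficient of order at most l. *)
pose Q1 := Q - (Q`_0)%:P - 'X^(j.+1) - (p ^ n)%N%:Z%:P * V.
have Q1E : Q1 = drop_poly l.+1 Q1 * 'X^(l.+1).
  rewrite -[LHS](poly_take_drop l.+1) [X in X + _](_ : _ = 0) ?add0r //.
  apply/polyP => i; rewrite coef_take_poly coef0; case: ltnP => // il.
  rewrite /Q1 !coefB coefC coefXn coefCM.
  have VC (t : nat) : V`_t = if t is t'.+1 then \sum_(u < l) v' 0 u * (t' == u)%:R else 0.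
    rewrite coef_sum; case: t => [|t]; last by apply: eq_bigr => u _; rewrite coefZ coefXn eqSS.
    by rewrite big1 // => u _; rewrite coefZ coefXn mulr0.
  rewrite VC; case: i il => [|i] il /=; first by rewrite mulr0 !subr0 subrr.
  rewrite ltnS in il; rewrite subr0 eqSS.
  have := congr1 (fun B : 'rV_l => B 0 (Ordinal il)) rA.
  rewrite !mxE eqxx /=; under eq_bigr do rewrite mxE /=.
  have -> : \sum_(u < l) v' 0 u * (i == u)%:R = v' 0 (Ordinal il).
    rewrite (bigD1 (Ordinal il)) //= eqxx mulr1 big1 ?addr0 // => u ui.
    by rewrite (_ : (i == u) = (Ordinal il == u)) // eq_sym (negPf ui) mulr0.
  have -> : Q`_i.+1 = \sum_m r 0 m * (H m)`_i.+1.
    by rewrite coef_sum; apply: eq_bigr => m _; rewrite coefCM.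
  by move=> ->; rewrite -val_eqE /=; ring.
exists (fun m => r 0 m), (- Q`_0), (drop_poly l.+1 Q1 \Po ('X - xi%:P)), (V \Po ('X - xi%:P)).
have QE : Q = (Q`_0)%:P + 'X^(j.+1) + drop_poly l.+1 Q1 * 'X^(l.+1) + (p ^ n)%N%:Z%:P * V.
  by rewrite -Q1E /Q1; ring.
have := congr1 (fun q => q \Po ('X - xi%:P)) QE.
rewrite !(comp_polyD, comp_polyM, comp_polyC, comp_Xn_poly) /Q.
have -> : (\sum_m (r 0 m)%:P * H m) \Po ('X - xi%:P) = \sum_m (r 0 m)%:P * G m.
  rewrite raddf_sum; apply: eq_bigr => m _ /=.
  have X0 : ('X + xi%:P) \Po ('X - xi%:P) = 'X.
    by rewrite comp_polyD comp_polyX comp_polyC subrK.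
  by rewrite comp_polyM comp_polyC /H -comp_polyA X0 comp_polyXr.
by rewrite -/(Q) => ->; rewrite polyCN; ring.
Qed.

End Jets.

(** * Degree l decoupling inside the bilinear expression *)

Section LowerDimension.
Variable R : realType.
Local Notation C := (R[i]).

(** Both sides have the same homogeneity in each factor, so [mu] is a pure constant. The condition
    modulo p is the transversality of the two classes. *)
Definition bilinear_bound k p N M (Om : finType) (w : Om -> R) (f : nat -> Om -> C)
    (c : nat -> R) l a b (mu : R) :=
  forall i j, (i < p ^ a)%N -> (j < p ^ b)%N -> (i %% p != j %% p)%N ->
    \sum_o w o * (sqn (gsum p M a i (f^~ o)) ^+ tri l *
                  sqn (gsum p M b j (f^~ o)) ^+ (tri k - tri l)) <=
    mu * (gsum p N a i c ^+ tri l * gsum p N b j c ^+ (tri k - tri l)).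

(** A phase that is constant modulo q on the class of j multiplies the whole sum over that class by
    one unimodular number. This is what allows |F_j| to enter the weight. *)
Lemma sqn_gsum_sym (Om : finType) (f : nat -> Om -> C) z q (T : {perm Om}) u
    (g : {poly int}) c0 p M b j o :
  sqn z = 1 -> z ^+ q = 1 -> sqn u = 1 ->
  (forall x o, f x (T o) = u * z ^ g.[x%:Z] * f x o) ->
  (forall y : nat, exists t, g.[(j + p ^ b * y)%N%:Z] = c0 + q%:Z * t) ->
  sqn (gsum p M b j (f^~ (T o))) = sqn (gsum p M b j (f^~ o)).
Proof.
move=> z1 zq u1 fT gc.
have z0 : z != 0 by rewrite -sqn_eq0 z1 oner_neq0.
have -> : gsum p M b j (f^~ (T o)) = u * z ^ c0 * gsum p M b j (f^~ o).
  rewrite /gsum mulr_sumr; apply: eq_bigr => y _.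
  by rewrite fT (exprz_congr z0 zq (gc y)).
by rewrite !sqnM u1 sqn_exprz // !mul1r.
Qed.

Lemma sub_eqmod_neq (p i j t : nat) : (i %% p != j %% p)%N ->
  ~~ (p%:Z %| (i + p * t)%N%:Z - j%:Z)%Z.
Proof.
apply: contra => /dvdzP [q e]; apply/eqP.
have : (i%:Z = j%:Z + (q - t%:Z) * p%:Z)%R by rewrite PoszD PoszM in e; lia.
move=> /(congr1 (modz^~ p%:Z)); rewrite addrC modzMDl !modz_nat.
by case.
Qed.

(* Degree l decoupling on the class of i, the factor on the class of j being
   absorbed in the weight. *)
Lemma admissible_project k l p N M (Om : finType) (w : Om -> R) f (z : C) c a b a1 i j mu :
  prime p -> (k < p)%N -> (0 < l)%N -> (l < k)%N -> (0 < a)%N -> (a <= a1)%N ->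
  (l * a1 = (k - l).+1 * b)%N -> (a1 <= N)%N -> (b <= N)%N -> (N <= M)%N ->
  (i < p ^ a)%N -> (j < p ^ b)%N -> (i %% p != j %% p)%N ->
  admissible k p N M w f z c -> 0 < mu ->
  bilinear_bound k p N M w f c l a1 b mu ->
  admissible l p (a1 - a) (M - a)
    (fun o => w o * sqn (gsum p M b j (f^~ o)) ^+ (tri k - tri l)
              / (mu * gsum p N b j c ^+ (tri k - tri l)))
    (fun y => f (i + p ^ a * y)%N)
    (z ^+ (p ^ (k * N - l * (a1 - a))))
    (fun y => gsum p N a1 (i + p ^ a * y) c).
Proof.
move=> pp kp l0 lk a0 aa1 la1 a1N bN NM ia jb ij [pz w0 nd c0 H] mu0 bil.
have p0 := prime_gt0 pp.
have z1 : sqn z = 1 by apply: sqn_unity (prim_expr_order pz); rewrite expn_gt0 p0.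
have z0 : z != 0 by rewrite -sqn_eq0 z1 oner_neq0.
have S0 a' i' : 0 < gsum p N a' i' c by exact: gsum_gt0.
have kl : (l * (a1 - a) <= k * N)%N by apply: leq_mul; [exact: ltnW|lia].
have kl1 : (l * a1 <= k * N)%N by apply: leq_mul => //; exact: ltnW.
split.
- rewrite expnB //; apply: dvdn_prim_root => //.
  by rewrite dvdn_exp2l.
- move=> o; apply: divr_ge0; last by rewrite ltW // mulr_gt0 // exprn_gt0.
  by rewrite mulr_ge0 // exprn_ge0 // sqn_ge0.
- move=> xi [|jj] jjl.
    exists 0; rewrite mulr0 addr0 expr0 -polyC1.
    by apply: phase_symC; rewrite sqnX z1 expr1n.
  pose xi' := (i + p ^ a * xi)%N.
  have /choice [e He] : forall m : 'I_l, exists e : {poly int},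
     phase_sym w f z (('X - j%:Z%:P) ^+ (k - l + m).+1 +
        p%:Z%:P * ('X - j%:Z%:P) ^+ k.+1 * e).
    by move=> m; apply: nd; have := ltn_ord m; lia.
  have xj : ~~ (p%:Z %| xi'%:Z - j%:Z)%Z.
    rewrite /xi' -(prednK a0) expnS -mulnA.
    exact: sub_eqmod_neq.
  (* The l-jet of order jj + 1 is realized modulo p ^ (k N), which is the order of [z]. *)
  have [r [c1 [E [E' HE]]]] := jets_elim (k * N) e (Ordinal jjl) pp kp (ltnW lk) xj.
  (* Chosen so that K p ^ (a (jj + 1)) is the exponent of the new root of unity. *)
  pose K := (p ^ (k * N - l * a1 + a * (l - jj.+1)))%N.
  have := phase_symZ z1 K%:Z (phase_symD z1 (phase_sym_sum z1 r He) (phase_symC w f z1 c1)).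
  set h := _ * _; move=> [T [u [u1 wT fT]]].
  (* The error of order l + 1 is left with p ^ (a (l - jj - 1) + a); one factor p is set aside for
     the form that nondegeneracy requires. *)
  exists ((p ^ (a * (l - jj.+1) + a - 1))%N%:Z%:P * (E \Po (i%:Z%:P + (p ^ a)%N%:Z%:P * 'X))).
  exists T, u; split=> //; last first.
    move=> y o.
    rewrite fT [X in _ = _ * X ^ _ * _]exprnP exprz_exp; congr (_ * _ * _).
    apply: (exprz_congr z0 (prim_expr_order pz)).
    rewrite /h HE; exists (K%:Z * E'.[(i + p ^ a * y)%N%:Z]).
    have -> : (p ^ (k * N - l * (a1 - a)) = p ^ (k * N - l * a1) * (p ^ a) ^ l)%N.
      by rewrite -expnM -expnD mulnBr subnBA ?leq_mul2l ?aa1 ?orbT // (mulnC a) addnBAC.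
    have pB : p%:Z * (p ^ (a * (l - jj.+1) + a - 1))%N%:Z = (p%:Z ^+ a) ^+ (l - jj.+1) * p%:Z ^+ a.
      rewrite -PoszM -expnS -exprM -exprD -Posz_exp; congr (Posz (_ ^ _)%N).
      by rewrite subn1 prednK ?addn_gt0 ?a0 ?orbT.
    have Al : (p%:Z ^+ a) ^+ l = (p%:Z ^+ a) ^+ (l - jj.+1) * (p%:Z ^+ a) ^+ jj.+1.
      by rewrite -exprD subnK.
    move: pB; set B := Posz (p ^ (_ - 1))%N => pB.
    have KE : K%:Z = (p ^ (k * N - l * a1))%N%:Z * (p%:Z ^+ a) ^+ (l - jj.+1).
      by rewrite /K expnD PoszM expnM !Posz_exp.
    rewrite !(hornerD, hornerM, hornerC, hornerX, hornerN, horner_exp, horner_comp).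
    rewrite /xi' !(PoszM, PoszD) KE.
    move: (Posz (p ^ (k * N))) (Posz (p ^ (k * N - _))) => U V.
    rewrite !Posz_exp; move: (p%:Z ^+ a) pB Al => A pB Al.
    have -> : i%:Z + A * y%:Z - (i%:Z + A * xi%:Z) = A * (y%:Z - xi%:Z) by ring.
    rewrite !exprMn (exprS A l) Al(mulrACA p%:Z) pB.
    by move: E.[_] E'.[_] => E1 E2 /=; ring.
  move=> o.
  have -> : sqn (gsum p M b j (f^~ (T o))) = sqn (gsum p M b j (f^~ o)).
    apply: (sqn_gsum_sym (c0 := K%:Z * c1) _ _ z1 (prim_expr_order pz) u1 fT) => y.
    (* On the class of j every power used has order at least k - l + 1. As l a1 = (k - l + 1) b, the
       factor K makes these terms multiples of p ^ (k N), so |F_j| is unchanged. *)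
    have KE : (K * (p ^ b) ^ (k - l).+1 = p ^ (k * N) * p ^ (a * (l - jj.+1)))%N.
      by rewrite -expnM -!expnD (mulnC b) -la1 -addnA addnCA addnC subnK // addnC.
    exists ((p ^ (a * (l - jj.+1)))%N%:Z * \sum_m r m * ((p ^ b)%N%:Z ^+ m * y%:Z ^+ (k - l + m).+1
       + p%:Z * ((p ^ b)%N%:Z ^+ l * y%:Z ^+ k.+1) * (e m).[(j + p ^ b * y)%N%:Z])).
    rewrite mulrA -PoszM -KE PoszM -mulrA mulr_sumr /h hornerM hornerC hornerD horner_sum hornerC.
    rewrite [RHS]addrC mulrDr; congr (_ + _); rewrite mulr_sumr mulr_sumr; apply: eq_bigr => m _.
    rewrite !(hornerD, hornerM, hornerC, hornerX, hornerN, horner_exp).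
    move: (e m).[_] => Em; rewrite PoszD PoszM !Posz_exp; move: (p%:Z ^+ b) => B.
    have -> : j%:Z + B * y%:Z - j%:Z = B * y%:Z by ring.
    have Bk : B ^+ k.+1 = B ^+ (k - l).+1 * B ^+ l by rewrite -exprD addSn subnK // ltnW.
    rewrite !exprMn -addSn (exprD B) Bk.
    ring.
  by rewrite wT.
- by move=> J; apply: S0.
- move=> J JN.
  have iJ : (i + p ^ a * J < p ^ a1)%N by rewrite -(subnKC aa1) expnD ltn_add_mul.
  have iJp : ((i + p ^ a * J) %% p != j %% p)%N.
    by rewrite -(prednK a0) expnS -mulnA addnC mulnC modnMDl.
  have mS : 0 < mu * gsum p N b j c ^+ (tri k - tri l) by rewrite mulr_gt0 // exprn_gt0.
  rewrite -(ler_pM2r mS) mulr_suml.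
  have := bil _ _ iJ jb iJp; rewrite [X in _ <= X -> _]mulrCA => /(le_trans _); apply.
  apply: ler_sum => o _; rewrite (gsum_rescale _ _ _ _ (f^~ o)); last by lia.
  rewrite subnKC // mulrAC divfK ?gt_eqF //.
  by rewrite -mulrA [X in _ <= _ * X]mulrC.
Qed.

(** Decoupling the projected system into its a1 - a levels and undoing the normalization of the
    weight coarsens the class of i from p ^ a1 to p ^ a at the cost [D]. *)
Lemma lower_decoupling k l p N M (Om : finType) (w : Om -> R) f (z : C) c a b a1 mu D :
  prime p -> (k < p)%N -> (0 < l)%N -> (l < k)%N -> (0 < a)%N -> (a <= a1)%N ->
  (l * a1 = (k - l).+1 * b)%N -> (a1 <= N)%N -> (b <= N)%N -> (N <= M)%N ->
  admissible k p N M w f z c -> 0 < mu ->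
  decoupling l p (a1 - a) D ->
  bilinear_bound k p N M w f c l a1 b mu ->
  bilinear_bound k p N M w f c l a b (D * mu).
Proof.
move=> pp kp l0 lk a0 aa1 la1 a1N bN NM adm mu0 dec bil i j ia jb ij.
have adm' := admissible_project pp kp l0 lk a0 aa1 la1 a1N bN NM ia jb ij adm mu0 bil.
have aN := leq_trans aa1 a1N.
have c0 : forall J, 0 < c J by case: adm.
have mS : 0 < mu * gsum p N b j c ^+ (tri k - tri l).
  by rewrite mulr_gt0 // exprn_gt0 // gsum_gt0 // prime_gt0.
have := dec _ _ _ _ _ _ (leq_sub2r a (leq_trans a1N NM)) adm'.
rewrite -(ler_pM2r mS) mulr_suml.
rewrite (_ : gsum p (a1 - a) 0 0 _ = gsum p N a i c); last first.
  rewrite (gsum_split0 _ _ (leqnn _)) (@gsum_split _ p N a (a1 - a)) ?subnKC //.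
  by apply: eq_bigr => t _; rewrite gsum_id.
rewrite [X in _ <= X -> _]mulrACA => /(le_trans _); apply.
  apply: ler_sum => o _; rewrite (gsum_rescale _ _ _ _ (f^~ o)); last by lia.
  rewrite addn0 muln0 addn0 mulrAC divfK ?gt_eqF //.
  by rewrite -mulrA [X in _ <= _ * X]mulrC.
Qed.

End LowerDimension.

(** * Hoelder's step, trivial bilinear bounds and the broad-narrow reduction *)

Lemma tri_double k : (2 * tri k = k * k.+1)%N.
Proof.
elim: k => [|k IH]; first by rewrite tri0.
by rewrite triS mulnDr IH; lia.
Qed.

Lemma tri_leq k l : (l <= k)%N -> (tri l <= tri k)%N.
Proof. by move=> lk; have := tri_double k; have := tri_double l; nia. Qed.

(** With k = n + l + 1, this balances the exponents of |F_i| when Hoelder's inequality passes from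
    degree l + 1 to degrees n and l; the next identity does the same for |F_j|. *)
Lemma tri_hoelder1 n l :
  (tri l.+1 * n.+1 + tri n = tri (n + l.+1) + tri l * n)%N.
Proof.
apply/eqP; rewrite -(eqn_pmul2l (isT : 0 < 2)%N) !mulnDr !mulnA !tri_double; apply/eqP; lia.
Qed.

Lemma tri_hoelder2 n l :
  (tri (n + l.+1) * n.+1 + tri l * n = tri l.+1 * n.+1 + tri n + tri (n + l.+1) * n)%N.
Proof. by rewrite tri_hoelder1 mulnS; lia. Qed.

Section Multilinear.
Variable R : realType.
Local Notation C := (R[i]).

Lemma decoupling_mono k p N (D D' : R) : (0 < p)%N -> D <= D' ->
  decoupling k p N D -> decoupling k p N D'.
Proof.
move=> p0 DD dec Om w f z c M NM adm; apply: (le_trans (dec _ _ _ _ _ _ NM adm)).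
case: adm => _ _ _ c0 _.
by rewrite ler_wpM2r // exprn_ge0 // ltW // gsum_gt0.
Qed.

Section Fixed.
Variables (k p N M : nat) (Om : finType) (w : Om -> R) (f : nat -> Om -> C)
  (z : C) (c : nat -> R).
Hypothesis pp : prime p.
Hypothesis NM : (N <= M)%N.
Hypothesis adm : admissible k p N M w f z c.

Let p0 : (0 < p)%N := prime_gt0 pp.
Let w0 o : 0 <= w o.
Proof. by case: adm. Qed.
Let c0 J : 0 < c J.
Proof. by case: adm. Qed.
Let S0 a i : 0 < gsum p N a i c.
Proof. exact: gsum_gt0. Qed.
Let F0 a i o n : 0 <= sqn (gsum p M a i (f^~ o)) ^+ n.
Proof. by rewrite exprn_ge0 // sqn_ge0. Qed.

Lemma bilinear_bound_mono l a b mu mu' : mu <= mu' ->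
  bilinear_bound k p N M w f c l a b mu -> bilinear_bound k p N M w f c l a b mu'.
Proof.
move=> mm bil i j ia jb ij; apply: (le_trans (bil _ _ ia jb ij)).
by rewrite ler_wpM2r // ltW // mulr_gt0 // exprn_gt0.
Qed.

(** The power (k - l).+1 of the integrand is exactly the integrand of degree k - l with the classes
    exchanged, times the power k - l of the integrand of degree l - 1. *)
Lemma bilinear_bound_hoelder l a b mu1 mu2 G : (0 < l <= k)%N ->
  0 < mu1 -> 0 < mu2 -> 0 < G -> G ^+ (k - l).+1 = mu1 * mu2 ^+ (k - l) ->
  bilinear_bound k p N M w f c (k - l) b a mu1 ->
  bilinear_bound k p N M w f c l.-1 a b mu2 ->
  bilinear_bound k p N M w f c l a b G.
Proof.
move=> /andP [l0 lk] mu10 mu20 G0 eG bil1 bil2 i j ia jb ij.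
have e1 : (tri l * (k - l).+1 = tri k - tri (k - l) + tri l.-1 * (k - l))%N.
  have := tri_hoelder1 (k - l) l.-1; rewrite prednK // subnK //.
  by have := tri_leq (leq_subr l k); lia.
have e2 : ((tri k - tri l) * (k - l).+1 = tri (k - l) + (tri k - tri l.-1) * (k - l))%N.
  have := tri_hoelder2 (k - l) l.-1; rewrite prednK // subnK // !mulnBl.
  have := leq_mul (tri_leq lk) (leqnn (k - l).+1).
  have := leq_mul (tri_leq (leq_trans (leq_pred l) lk)) (leqnn (k - l)).
  lia.
have S0' a' i' n : 0 < gsum p N a' i' c ^+ n by rewrite exprn_gt0.
have powE (x y : R) : (x ^+ tri l * y ^+ (tri k - tri l)) ^+ (k - l).+1 =
    (y ^+ tri (k - l) * x ^+ (tri k - tri (k - l))) *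
    (x ^+ tri l.-1 * y ^+ (tri k - tri l.-1)) ^+ (k - l).
  rewrite !exprMn -!exprM e1 e2 !exprD; ring.
have ji : (j %% p != i %% p)%N by rewrite eq_sym.
apply: (hoelder_sum_bound (n := k - l) w0 _ _ _ _ _ _ _ _
  (bil1 _ _ jb ia ji) (bil2 _ _ ia jb ij)).
- by move=> o; rewrite mulr_ge0.
- by move=> o; rewrite mulr_ge0.
- by move=> o; rewrite mulr_ge0.
- by move=> o /=; rewrite powE.
- by rewrite !mulr_gt0.
- by rewrite !mulr_gt0.
- by rewrite !mulr_gt0.
- rewrite exprMn powE eG [in RHS]exprMn; ring.
Qed.

Lemma bilinear_bound0 a b D : (b <= N)%N -> decoupling k p (N - b) D ->
  bilinear_bound k p N M w f c 0 a b D.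
Proof.
move=> bN dec i j ia jb ij.
rewrite tri0 subn0 expr0 mul1r.
under eq_bigr do rewrite expr0 mul1r.
exact: (decoupling_rescale p0 bN NM jb dec adm).
Qed.

(** After normalization the product of complementary powers of u and v is at most u ^ tri k + v ^
    tri k, and each summand is handled by rescaling. This gives the factor 2. *)
Lemma bilinear_bound_trivial l a b D : (l <= k)%N -> (a <= N)%N -> (b <= N)%N ->
  decoupling k p (N - a) D -> decoupling k p (N - b) D ->
  bilinear_bound k p N M w f c l a b (2 * D).
Proof.
move=> lk aN bN deca decb i j ia jb ij.
have := decoupling_rescale p0 aN NM ia deca adm.
have := decoupling_rescale p0 bN NM jb decb adm.
have Fa0 o : 0 <= sqn (gsum p M a i (f^~ o)) by rewrite sqn_ge0.
have Fb0 o : 0 <= sqn (gsum p M b j (f^~ o)) by rewrite sqn_ge0.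
move: (S0 a i) (S0 b j).
move: (gsum p N a i c) (gsum p N b j c) => Sa Sb Sa0 Sb0 Hb Ha.
have kl := tri_leq lk.
rewrite -ler_pdivrMr ?mulr_gt0 ?exprn_gt0 // mulr_suml.
rewrite -ler_pdivrMr ?exprn_gt0 // mulr_suml in Ha.
rewrite -ler_pdivrMr ?exprn_gt0 // mulr_suml in Hb.
have -> : 2 * D = D + D by ring.
apply: le_trans (lerD Ha Hb); rewrite -big_split /=; apply: ler_sum => o _.
rewrite -!mulrA -mulrDr ler_wpM2l //.
move: (Fa0 o) (Fb0 o).
move: (sqn (gsum p M a i _)) (sqn (gsum p M b j _)) => x y x0 y0.
rewrite mulrA invfM mulrACA -!expr_div_n.
have x1 : 0 <= x / Sa by rewrite divr_ge0 // ltW.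
have y1 : 0 <= y / Sb by rewrite divr_ge0 // ltW.
move: (x / Sa) (y / Sb) x1 y1 => u v u0 v0.
have e : tri k = (tri l + (tri k - tri l))%N by rewrite subnKC.
have [uv|/ltW uv] := leP u v.
  apply: ler_wpDl; first by rewrite exprn_ge0.
  rewrite [X in _ <= _ ^+ X]e exprD; apply: ler_wpM2r; first by rewrite exprn_ge0.
  exact: ler_exp_nneg.
apply: ler_wpDr; first by rewrite exprn_ge0.
rewrite [X in _ <= _ ^+ X]e exprD; apply: ler_wpM2l; first by rewrite exprn_ge0.
exact: ler_exp_nneg.
Qed.

(** The dichotomy is applied to the p classes modulo p. The narrow part is decoupled with N - 1
    levels. In the broad part the class of j is first split modulo p ^ B by the triangle inequality;
    the p ^ 2 pairs and p ^ (B - 1) subclasses make the factor p ^ (B + 1). *)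
Lemma broad_narrow_bound l B D1 mu :
  (0 < l < k)%N -> (0 < B <= N)%N -> 0 <= mu -> 0 <= D1 ->
  decoupling k p (N - 1) D1 ->
  bilinear_bound k p N M w f c l 1 B mu ->
  \sum_o w o * sqn (gsum p M 0 0 (f^~ o)) ^+ tri k <=
  (4 ^+ tri k * D1 + (4 * p%:R ^+ 2) ^+ tri k * p%:R ^+ (2 * B * tri k) *
     p%:R ^+ (B + 1) * mu) * gsum p N 0 0 c ^+ tri k.
Proof.
move=> /andP [l0 lk] /andP [B0 BN] mu0 D10 dec bil.
have N1 : (1 <= N)%N by apply: leq_trans BN.
have kl := tri_leq (ltnW lk).
set s := tri k; set S := gsum p N 0 0 c.
pose F1 (t : 'I_(p ^ 1)) o := sqn (gsum p M 1 t (f^~ o)).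
have Sle a i : (a <= N)%N -> (i < p ^ a)%N -> gsum p N a i c <= S.
  move=> aN ia; rewrite /S (gsum_split0 _ _ aN) (bigD1 (Ordinal ia)) //= lerDl.
  by rewrite sumr_ge0 // => t _; rewrite ltW.
have H1 : \sum_o w o * sqn (gsum p M 0 0 (f^~ o)) ^+ s <=
   4 ^+ s * (\sum_(t < p ^ 1) \sum_o w o * F1 t o ^+ s) +
   (4 * p%:R ^+ 2) ^+ s * (\sum_(i < p ^ 1) \sum_(j < p ^ 1 | j != i)
      \sum_o w o * (F1 i o ^+ tri l * F1 j o ^+ (s - tri l))).
  rewrite exchange_big /=.
  under [X in _ <= _ + _ * X]eq_bigr do rewrite exchange_big /=.
  rewrite [X in _ <= _ + _ * X]exchange_big /= !mulr_sumr -big_split /=.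
  apply: ler_sum => o _.
  rewrite (gsum_split0 _ _ (leq_trans N1 NM)) -mulr_sumr.
  under [X in _ <= _ + _ * X]eq_bigr do rewrite -mulr_sumr.
  rewrite -mulr_sumr !(mulrCA _ (w o)) -mulrDr ler_wpM2l //.
  have := @broad_narrow R (p ^ 1) s (tri l) (fun t => gsum p M 1 t (f^~ o)).
  have -> : (p ^ 1)%:R = p%:R :> R by rewrite expn1.
  by apply => //; rewrite expn1; exact: prime_gt1.
apply: (le_trans H1); rewrite [leRHS]mulrDl; apply: lerD.
  rewrite -mulrA ler_wpM2l ?exprn_ge0 //.
  apply: (@le_trans _ _ (\sum_(t < p ^ 1) D1 * gsum p N 1 t c ^+ s)).
    by apply: ler_sum => t _; exact: (decoupling_rescale p0 N1 NM _ dec adm).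
  rewrite -mulr_sumr ler_wpM2l // /S (gsum_split0 _ _ N1).
  by apply: sum_exp_le => [|t]; [apply: tri_gt0; lia|rewrite ltW].
rewrite -!mulrA; apply: ler_wpM2l; first by rewrite exprn_ge0 // mulr_ge0 // exprn_ge0.
have P0 n : 0 <= p%:R ^+ n :> R by rewrite exprn_ge0.
have P1 : 1 <= p%:R :> R by rewrite ler1n.
have S00 : 0 <= S by rewrite ltW // S0.
have pair (i j : 'I_(p ^ 1)) : j != i ->
    \sum_o w o * (F1 i o ^+ tri l * F1 j o ^+ (s - tri l)) <=
    p%:R ^+ (2 * B * s) * (p%:R ^+ (B - 1) * (mu * S ^+ s)).
  move=> ji.
  have ijp : (i %% p != j %% p)%N.
    have ip : (i < p)%N by rewrite -[p in (_ < p)%N]expn1.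
    have jp : (j < p)%N by rewrite -[p in (_ < p)%N]expn1.
    by rewrite !modn_small // eq_sym (inj_eq val_inj).
  have jt (t : 'I_(p ^ (B - 1))) : (j + p ^ 1 * t < p ^ B)%N.
    by rewrite -[in X in (_ < X)%N](subnKC B0) expnD ltn_add_mul.
  apply: (@le_trans _ _ (p%:R ^+ (2 * B * s) * \sum_(t < p ^ (B - 1)) \sum_o
      w o * (F1 i o ^+ tri l * sqn (gsum p M B (j + p ^ 1 * t) (f^~ o)) ^+ (s - tri l)))).
    rewrite exchange_big /= mulr_sumr; apply: ler_sum => o _.
    rewrite -mulr_sumr -mulr_sumr [leRHS]mulrCA ler_wpM2l // [leRHS]mulrCA ler_wpM2l ?F0 //.
    rewrite /F1 (@gsum_split _ p M 1 (B - 1)) ?subnKC ?(leq_trans BN) //.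
    apply: le_trans (sqn_sum_le _ _ _) _; first by rewrite expn_gt0 p0.
    apply: ler_wpM2r; first by apply: sumr_ge0 => t _; exact: F0.
    rewrite natrX -exprM; apply: ler_weXn2l => //.
    by rewrite mulnA (mulnC _ 2) leq_mul // ?leq_mul // ?leq_subr //.
  apply: ler_wpM2l => //.
  apply: (@le_trans _ _ (\sum_(t < p ^ (B - 1)) mu * S ^+ s)).
    apply: ler_sum => t _.
    have ijt : (i %% p != (j + p ^ 1 * t) %% p)%N.
      rewrite (_ : j + p ^ 1 * t = t * p + j)%N ?modnMDl // (mulnC _ (t : nat)) addnC.
      by congr (_ * _ + _)%N; exact: expn1.
    apply: le_trans (bil _ _ (ltn_ord i) (jt t) ijt) _.
    apply: ler_wpM2l => //; rewrite (_ : S ^+ s = S ^+ tri l * S ^+ (s - tri l)); last by rewrite -exprD subnKC.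
    have Sn a' i' : 0 <= gsum p N a' i' c by rewrite ltW.
    apply: ler_pM; [exact: exprn_ge0|exact: exprn_ge0| |].
      by apply: ler_exp_nneg => //; exact: Sle.
    by apply: ler_exp_nneg => //; exact: Sle.
  by rewrite sumr_const card_ord -[leLHS]mulr_natl natrX.
apply: (@le_trans _ _ (\sum_(i < p ^ 1) \sum_(j < p ^ 1)
    p%:R ^+ (2 * B * s) * (p%:R ^+ (B - 1) * (mu * S ^+ s)))).
  have K0 : 0 <= p%:R ^+ (2 * B * s) * (p%:R ^+ (B - 1) * (mu * S ^+ s)).
    by rewrite !mulr_ge0 // exprn_ge0.
  apply: ler_sum => i _; rewrite [leRHS](bigID (fun j => j != i)) /=.
  apply: ler_wpDr; first by apply: sumr_ge0.
  by apply: ler_sum => j ji; exact: pair.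
have c1 (x : R) : \sum_(j < p ^ 1) x = p%:R * x.
  by rewrite sumr_const card_ord expn1 mulr_natl.
rewrite !c1 [leLHS](_ : _ = p%:R ^+ (2 * B * s) *
  (p%:R * (p%:R * p%:R ^+ (B - 1)) * (mu * S ^+ s))); last by ring.
by rewrite -!exprS subn1 prednK // addn1.
Qed.

End Fixed.
End Multilinear.

(** * Iterating lower degree decoupling and Hoelder's inequality *)

Section Iteration.
Variable R : realType.
Local Notation C := (R[i]).

(* The exponents gained by r rounds of lower degree decoupling and Hoelder. *)
Fixpoint gain (k r l : nat) : R :=
  if r is r'.+1 then
    if l is l'.+1 then
      gain k r' (k - l) / l%:R + (k - l)%:R / (k - l).+1%:R * gain k r' l'
    else 1
  else (l == 0)%:R.

Lemma gain0 k r : gain k r 0 = 1.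
Proof. by case: r. Qed.

(* The weights of gain k r m, for 0 < m < k, in the next round add up to 1, so only
   the inflow from gain k r 0 = 1 changes the sum. *)
Lemma gain_sum k r : (0 < k)%N ->
  \sum_(1 <= l < k) gain k r l = r%:R * (k.-1%:R / k%:R).
Proof.
case: k => // k _; elim: r => [|r IH].
  by rewrite mul0r big_nat_cond big1 // => -[|l].
pose h m : R := (k - m)%:R / (k - m).+1%:R * gain k.+1 r m.
have E1 : \sum_(0 <= l < k) gain k.+1 r (k.+1 - l.+1) / l.+1%:R =
    \sum_(1 <= m < k.+1) gain k.+1 r m / (k.+1 - m)%:R.
  rewrite [RHS]big_nat_rev /= [RHS]big_add1 /=; apply: eq_big_nat => l /andP [_ lk].
  by congr (gain _ _ _ / _%:R); lia.
have E2 : \sum_(0 <= l < k) (k.+1 - l.+1)%:R / (k.+1 - l.+1).+1%:R * gain k.+1 r l =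
    k%:R / k.+1%:R + \sum_(1 <= m < k.+1) h m.
  transitivity (\sum_(0 <= l < k.+1) h l); last first.
    by rewrite big_nat_recl // /h subn0 gain0 mulr1 [in RHS]big_add1.
  by rewrite big_nat_recr //= {2}/h subnn !mul0r addr0.
rewrite big_add1 big_split /= E1 E2 addrCA -big_split /= -[r.+1%:R]natr1 mulrDl mul1r.
rewrite -[k%:R / _]/(k.+1.-1%:R / _) -IH addrC.
congr (_ + _); apply: eq_big_nat => l /andP [l0 lk].
rewrite /h subSn // -natr1.
have : (k - l)%:R + 1 != 0 :> R by rewrite natr1 pnatr_eq0.
by move=> ?; field.
Qed.

(** The k - 1 gains sum to r (k - 1) / k, so their average is r / k. *)
Lemma gain_pigeonhole k r : (1 < k)%N ->
  exists2 l, (0 < l < k)%N & r%:R / k%:R <= gain k r l.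
Proof.
move=> k1; have k0 := ltnW k1.
have k0' : 0 < k%:R :> R by rewrite ltr0n.
pose P l := r%:R / k%:R <= gain k r l.
have [/hasP [l] | /hasPn H] := boolP (has P (index_iota 1 k)).
  by rewrite mem_index_iota => lk Pl; exists l.
have : \sum_(1 <= l < k) gain k r l < \sum_(1 <= l < k) r%:R / k%:R.
  apply: ltr_sum_nat => // l lk; rewrite ltNge; apply: H.
  by rewrite mem_index_iota.
by rewrite gain_sum // sumr_const_nat subn1 -[X in _ < X]mulr_natr mulrA [X in _ < X]mulrAC ltxx.
Qed.

Section Fixed.
Variables (k p N M Q : nat) (Om : finType) (w : Om -> R) (f : nat -> Om -> C)
  (z : C) (c : nat -> R) (A La q : R).
Hypotheses (pp : prime p) (kp : (k < p)%N) (NM : (N <= M)%N) (QN : (Q <= N)%N).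
Hypothesis adm : admissible k p N M w f z c.
Hypotheses (A0 : 0 < A) (La1 : 1 <= La) (q1 : 1 <= q).
Hypothesis dec_smaller : forall N', (N' < N)%N -> decoupling k p N' (A * q `^ N'%:R).
Hypothesis dec_lower : forall l n, (0 < l < k)%N -> (n <= Q)%N -> decoupling l p n La.

Local Notation bound r l b := (2 * A * La ^+ r * q `^ (N%:R - gain k r l * b%:R)).

Let La0 : 0 < La := lt_le_trans ltr01 La1.
Let q0 : 0 < q := lt_le_trans ltr01 q1.

Lemma bilinear_bound_start r a b : (0 < b <= N)%N ->
  bilinear_bound k p N M w f c 0 a b (bound r 0 b).
Proof.
move=> /andP [b0 bN]; apply: (@bilinear_bound_mono R k p N M Om w f z c pp adm _ _ _ (A * q `^ (N - b)%:R)).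
  rewrite gain0 mul1r natrB // ler_wpM2r ?powR_ge0 //.
  have := exprn_ege1 r La1; have := A0; nra.
apply: (bilinear_bound0 pp NM adm) => //; apply: dec_smaller; lia.
Qed.

(** The condition on l a lets the scale a be refined to (k - l + 1) b / l. Divisibility by the power
    of k! keeps this integral for r rounds, and the bound by [Q] keeps all scales in the range where
    the lower degrees cost at most [La]. *)
Lemma bilinear_bound_iterate r l a b :
  (l < k)%N -> (0 < a)%N -> (0 < b)%N -> (l * a <= (k - l).+1 * b)%N ->
  (k`! ^ r %| b)%N -> (k ^ r.+1 * b <= Q)%N ->
  bilinear_bound k p N M w f c l a b (bound r l b).
Proof.
elim: r l a b => [|r IH] l a b lk a0 b0 lab rb bQ.
  have k0 : (0 < k)%N by apply: leq_trans lk.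
  have bN : (b <= N)%N.
    apply: leq_trans QN; apply: leq_trans bQ; rewrite expn1; nia.
  case: l lk lab => [|l] lk lab; first by apply: bilinear_bound_start; rewrite b0.
  have aN : (a <= N)%N.
    apply: leq_trans QN; apply: leq_trans bQ; rewrite expn1; nia.
  have D b' : (0 < b' <= N)%N -> decoupling k p (N - b') (A * q `^ N%:R).
    move=> bN'; apply: (@decoupling_mono R k p _ (A * q `^ (N - b')%:R)) => //.
    - exact: prime_gt0.
    - by rewrite ler_pM2l // ler_powR // ler_nat leq_subr.
    - by apply: dec_smaller; lia.
  rewrite /= mul0r subr0 expr0 mulr1 -mulrA.
  by apply: (bilinear_bound_trivial pp NM adm) => //; [exact: ltnW|apply: D; rewrite a0|apply: D; rewrite b0].
case: l lk lab => [|l] lk lab.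
  apply: bilinear_bound_start; rewrite b0 /=.
  apply: leq_trans QN; apply: leq_trans bQ.
  by rewrite leq_pmull // expn_gt0 (leq_trans _ lk).
have k0 : (0 < k)%N by apply: leq_trans lk.
have lb : (l.+1 %| b)%N.
  apply: dvdn_trans rb; apply: (@dvdn_trans k`!); last by rewrite expnS dvdn_mulr.
  by rewrite dvdn_fact //= ltnW.
pose a1 := ((k - l.+1).+1 * (b %/ l.+1))%N.
have la1 : (l.+1 * a1 = (k - l.+1).+1 * b)%N.
  by rewrite /a1 mulnCA [X in (_ * X)%N]mulnC divnK.
have aa1 : (a <= a1)%N by rewrite -(leq_pmul2l (ltn0Sn l)) la1.
have a1kb : (a1 <= k * b)%N.
  apply: leq_mul; first by lia.
  exact: leq_div.
have a10 : (0 < a1)%N by apply: leq_trans aa1.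
have kQ : (k * b <= Q)%N.
  by apply: leq_trans bQ; rewrite expnS leq_mul // leq_pmulr // expn_gt0 k0.
have a1Q : (a1 <= Q)%N := leq_trans a1kb kQ.
have bN : (b <= N)%N.
  by apply: leq_trans QN; apply: leq_trans kQ; rewrite leq_pmull.
have rb' : (k`! ^ r %| b)%N by apply: dvdn_trans rb; rewrite dvdn_exp2l.
have ra1 : (k`! ^ r %| a1)%N.
  apply: dvdn_mull; rewrite -(dvdn_pmul2l (ltn0Sn l)) [X in (_ %| X)%N]mulnC divnK //.
  apply: dvdn_trans rb; rewrite expnS dvdn_mul //.
  by rewrite dvdn_fact //= ltnW.
have P0 : 0 < 2 * A * La ^+ r by rewrite !mulr_gt0 // exprn_gt0.
have pw x : 0 < q `^ x by rewrite powR_gt0.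
set G := 2 * A * La ^+ r * q `^ (N%:R - gain k r.+1 l.+1 * b%:R).
have G0 : 0 < G by rewrite mulr_gt0.
apply: (@bilinear_bound_mono R k p N M Om w f z c pp adm _ _ _ (La * G)).
  by rewrite le_eqVlt; apply/orP; left; apply/eqP; rewrite /G exprS; ring.
apply: (@lower_decoupling R k l.+1 p N M Om w f z c a b a1 G La) => //.
- exact: leq_trans QN.
- by apply: dec_lower => //; apply: leq_trans a1Q; exact: leq_subr.
apply: (bilinear_bound_hoelder (mu1 := bound r (k - l.+1) a1) (mu2 := bound r l b) pp NM adm) => //.
- exact: ltnW.
- by rewrite mulr_gt0.
- by rewrite mulr_gt0.
- have a1E : a1%:R = (k - l.+1).+1%:R * b%:R / l.+1%:R :> R.
    by rewrite -natrM -la1 natrM mulrAC divff ?mul1r // pnatr_eq0.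
  rewrite exprMn exprS [X in _ = _ * X]exprMn [RHS]mulrACA; congr (_ * _).
  rewrite -!powR_mulrn ?powR_ge0 // -!powRrM -powRD; last by rewrite (gt_eqF q0) implybT.
  (* Since a1 = (k - l) b / (l + 1), comparing exponents of q gives exactly the recursion that
     defines [gain]. *)
  congr (_ `^ _); rewrite /= a1E -[(k - l.+1).+1%:R]natr1 -[l.+1%:R]natr1.
  have : (k - l.+1)%:R + 1 != 0 :> R by rewrite natr1 pnatr_eq0.
  have : l%:R + 1 != 0 :> R by rewrite natr1 pnatr_eq0.
  by move=> h1 h2; field; rewrite h1 h2.
- apply: IH => //; rewrite ?leq_subr //.
  + by rewrite ltn_subrL.
  + rewrite subKn; last exact: ltnW.
    apply: (@leq_trans ((k - l.+1).+1 * b)); first by rewrite leq_mul.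
    by rewrite -la1 leq_mul.
  + apply: leq_trans bQ. by rewrite [(k ^ r.+2)%N]expnSr -mulnA leq_mul.
- apply: IH => //.
  + exact: ltnW.
  + apply: (@leq_trans (l.+1 * a1)); first by rewrite leq_mul.
    by rewrite la1 leq_mul // subnSK // ltnW.
  + by apply: leq_trans bQ; rewrite leq_mul // leq_pexp2l.
Qed.

End Fixed.
End Iteration.

(** * Decoupling with epsilon loss, by induction on the degree and on N *)

Section Bound.
Variable R : realType.

(* The quantifier order matters: p is large depending on eps, C depends on p. *)
Definition epsilon_loss (k : nat) := forall eps : R, 0 < eps ->
  exists p0 : nat, forall p, prime p -> (p0 <= p)%N ->
    exists2 C : R, 1 <= C & forall N, decoupling k p N (C * (p%:R `^ eps) `^ N%:R).

(** One prime and one constant serve all lower degrees: the maximum of the thresholds and the sum of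
    the constants. *)
Lemma decoupling_uniform K :
  (forall l, (0 < l < K)%N -> epsilon_loss l) ->
  forall eps : R, 0 < eps ->
  exists p0 : nat, forall p, prime p -> (p0 <= p)%N ->
    exists2 C : R, 1 <= C & forall l N, (0 < l < K)%N ->
      decoupling l p N (C * (p%:R `^ eps) `^ N%:R).
Proof.
elim: K => [|K IH] H eps e0.
  by exists 0 => p _ _; exists 1 => // l N; rewrite ltn0 andbF.
have [|p1 H1] := IH _ eps e0; first by move=> l lK; apply: H; lia.
have [->|K0] := posnP K.
  by exists 0 => p _ _; exists 1 => // l N; lia.
have [|p2 H2] := H K _ eps e0; first by rewrite K0 ltnSn.
exists (maxn p1 p2) => p pp pge.
have [|C1 C11 D1] := H1 p pp; first by apply: leq_trans pge; exact: leq_maxl.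
have [|C2 C21 D2] := H2 p pp; first by apply: leq_trans pge; exact: leq_maxr.
exists (C1 + C2) => [|l N]; first by lra.
have q0 : 0 <= (p%:R `^ eps) `^ N%:R by exact: powR_ge0.
rewrite ltnS => /andP [l0]; rewrite leq_eqVlt => /orP [/eqP ->|lK].
  apply: decoupling_mono (D2 N); first exact: prime_gt0.
  by rewrite ler_wpM2r // lerDr; lra.
apply: decoupling_mono (D1 l N _); first exact: prime_gt0.
  by rewrite ler_wpM2r // lerDl; lra.
by rewrite l0.
Qed.

Lemma powR_ge1 (x e : R) : 1 <= x -> 0 <= e -> 1 <= x `^ e.
Proof. by move=> x1 e0; rewrite -[leLHS](powRr0 x) ler_powR. Qed.

Lemma powR_exp_nat (x e : R) (n : nat) : 0 <= x -> (x `^ e) ^+ n = x `^ (e * n%:R).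
Proof. by move=> x0; rewrite powRrM powR_mulrn // powR_ge0. Qed.

(** The terms are the powers of p lost to (4 p ^ 2) ^ s, the splitting modulo p ^ B, the number of
    classes, C ^ r, the lower degree losses, and the numerical factor 4. *)
Lemma iteration_exponent (s B : nat) : (0 < B)%N ->
  (3 * s + 2 * B * s + (B + 1) + B + B + 1 <= (5 * s + 6) * B)%N.
Proof. nia. Qed.

Lemma iteration_constant (p s r B Q : nat) (C eps g de : R) :
  (4 <= p)%N -> 1 <= C -> 0 < eps -> (0 < B)%N ->
  C ^+ r <= p%:R ^+ B -> de * Q%:R * r%:R = B%:R -> (5 * s + 6)%:R <= eps * g ->
  (4 * p%:R ^+ 2) ^+ s * p%:R ^+ (2 * B * s) * p%:R ^+ (B + 1) *
    (2 * (C * (p%:R `^ de) `^ Q%:R) ^+ r) <= 2^-1 * (p%:R `^ eps) `^ (g * B%:R).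
Proof.
move=> p4 C1 e0 B0 CB dQ eg.
have P4 : 4 <= p%:R :> R by rewrite ler_nat.
have P1 : 1 <= p%:R :> R by lra.
have P0 : 0 <= p%:R :> R by lra.
have La : (C * (p%:R `^ de) `^ Q%:R) ^+ r <= p%:R ^+ B * p%:R ^+ B.
  rewrite exprMn -powRrM powR_exp_nat // dQ powR_mulrn //.
  by rewrite ler_wpM2r // exprn_ge0.
have K : (4 * p%:R ^+ 2) ^+ s <= p%:R ^+ (3 * s) :> R.
  rewrite exprM; apply: ler_exp_nneg; first by rewrite mulr_ge0 // exprn_ge0.
  by rewrite (exprS _ 2) ler_wpM2r // exprn_ge0.
have -> : (p%:R `^ eps) `^ (g * B%:R) = p%:R `^ (eps * g * B%:R).
  by rewrite -powRrM mulrA.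
have E : p%:R ^+ ((5 * s + 6) * B) <= p%:R `^ (eps * g * B%:R) :> R.
  by rewrite -powR_mulrn // ler_powR // natrM ler_wpM2r.
have e1 : p%:R ^+ (3 * s + 2 * B * s + (B + 1) + B + B + 1) <= p%:R ^+ ((5 * s + 6) * B) :> R.
  by apply: ler_weXn2l => //; exact: iteration_exponent.
rewrite -ler_pdivrMl ?invr_gt0 // invrK.
apply: le_trans (le_trans e1 E).
set n3 := (3 * s)%N; set n2 := (2 * B * s)%N.
rewrite !(exprD _ _ 1) !(exprD _ _ B) (exprD _ _ (B + 1)) (exprD _ n3 n2) !(exprD _ _ 1) expr1.
have H1 : 4 * (p%:R ^+ B * p%:R ^+ B) <= p%:R ^+ B * p%:R ^+ B * p%:R :> R.
  by rewrite mulrC ler_wpM2l // mulr_ge0 // exprn_ge0.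
have H2 : 2 * (2 * (C * (p%:R `^ de) `^ Q%:R) ^+ r) <= p%:R ^+ B * p%:R ^+ B * p%:R.
  by apply: le_trans H1; lra.
set X := (C * _) ^+ r in H2 *.
have X0 : 0 <= X by rewrite exprn_ge0 // mulr_ge0 ?powR_ge0 //; lra.
have PX n : 0 <= p%:R ^+ n :> R by exact: exprn_ge0.
have a0 : 0 <= (4 * p%:R ^+ 2) ^+ s :> R by rewrite exprn_ge0 // mulr_ge0.
move: ((4 * p%:R ^+ 2) ^+ s) K a0 => a K a0.
move: (p%:R ^+ n3) K (PX n3) => a' K a'0.
move: (p%:R ^+ n2) (PX n2) => b PB2.
have b0 : 0 <= b * (p%:R ^+ B * p%:R) :> R by rewrite !mulr_ge0.
move: (p%:R ^+ B) (PX B) H2 b0 => PB PB0 H2 b0.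
have -> : 2 * (a * b * (PB * p%:R) * (2 * X)) =
  a * (b * (PB * p%:R)) * (2 * (2 * X)) by ring.
rewrite [leRHS](_ : _ = a' *
  (b * (PB * p%:R)) * (PB * PB * p%:R)); last by ring.
apply: ler_pM => //; first by rewrite mulr_ge0.
  by rewrite !mulr_ge0.
by rewrite ler_wpM2r.
Qed.

(** The parameters are chosen in the order r, [de], p, [C], [B], [Q], [A], none depending on N. In
    the induction on N the narrow and the broad part then each take at most half of the claimed
    bound. *)
Lemma epsilon_loss_step k : (1 < k)%N ->
  (forall l, (0 < l < k)%N -> epsilon_loss l) ->
  epsilon_loss k.
Proof.
move=> k1 H eps e0; set s := tri k.
have k0 := ltnW k1.
(* Enough rounds for the gain r / k, times eps, to reach the total loss 5 s + 6 per unit of B. *)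
pose r := (Num.truncn (k%:R * (5 * s + 6)%:R / eps)).+1.
have rE : (5 * s + 6)%:R <= eps * (r%:R / k%:R).
  have rgt : k%:R * (5 * s + 6)%:R / eps < r%:R by exact: truncnS_gt.
  rewrite ltr_pdivrMr // in rgt.
  by rewrite mulrA ler_pdivlMr ?ltr0n // mulrC (mulrC eps) ltW.
have [l0 l0k gE] := gain_pigeonhole R r k1.
set g := gain R k r l0 in gE.
have eg : (5 * s + 6)%:R <= eps * g by apply: (le_trans rE); rewrite ler_pM2l.
(* With Q = k ^ (r + 1) B, the r lower degree losses p ^ (de Q) multiply to exactly p ^ B. *)
pose de : R := (r%:R * (k ^ r.+1)%:R)^-1.
have de0 : 0 < de by rewrite invr_gt0 mulr_gt0 // ltr0n ?expn_gt0 ?k0.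
have [p1 H1] := decoupling_uniform H de0.
(* Ensures p ^ eps >= 2 * 4 ^ s, so that the saved level pays for the narrow part. *)
pose p2 := (Num.truncn ((2 * 4 ^+ s : R) `^ eps^-1)).+1.
exists (maxn (maxn p1 p2) (maxn 4 k.+1)) => p pp.
rewrite !geq_max => /andP [/andP [p1p p2p] /andP [p4 kp]].
have [C C1 D1] := H1 p pp p1p.
set q : R := p%:R `^ eps.
have P0 : 0 < p%:R :> R by rewrite ltr0n prime_gt0.
have qge : 2 * 4 ^+ s <= q.
  have x0 : 0 <= 2 * 4 ^+ s :> R by rewrite mulr_ge0 // exprn_ge0.
  have -> : 2 * 4 ^+ s = ((2 * 4 ^+ s) `^ eps^-1) `^ eps :> R.
    by rewrite -powRrM mulVf ?gt_eqF // powRr1.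
  rewrite ge0_ler_powR ?nnegrE ?powR_ge0 ?(ltW e0) ?(ltW P0) //.
  apply: le_trans (_ : p2%:R <= _); last by rewrite ler_nat.
  by rewrite ltW // truncnS_gt.
pose t := (Num.truncn (C ^+ r)).+1.
pose B := (k`! ^ r * t)%N.
have kf : (0 < k`! ^ r)%N by rewrite expn_gt0 fact_gt0.
have B0 : (0 < B)%N by rewrite muln_gt0 kf.
pose Q := (k ^ r.+1 * B)%N.
have CB : C ^+ r <= p%:R ^+ B.
  apply: le_trans (_ : t%:R <= _); first by rewrite ltW // truncnS_gt.
  rewrite -natrX ler_nat; apply: (@leq_trans B); first by rewrite leq_pmull.
  by rewrite ltnW // ltn_expl // prime_gt1.
have dQ : de * Q%:R * r%:R = B%:R.
  rewrite /de /Q natrM; field.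
  by rewrite !pnatr_eq0 -!lt0n expn_gt0 k0.
pose La := C * (p%:R `^ de) `^ Q%:R.
have pd1 : 1 <= p%:R `^ de by rewrite powR_ge1 ?ler1n ?prime_gt0 // ltW.
have dec_lower l n : (0 < l < k)%N -> (n <= Q)%N -> decoupling l p n La.
  move=> lk nQ; apply: decoupling_mono (D1 l n lk); first exact: prime_gt0.
  by rewrite ler_wpM2l ?ler_powR ?ler_nat //; lra.
have La1 : 1 <= La.
  have := C1; have : 1 <= (p%:R `^ de) `^ Q%:R by rewrite powR_ge1.
  rewrite /La; nra.
have q1 : 1 <= q by rewrite powR_ge1 ?ler1n ?prime_gt0 // ltW.
have q0 : 0 < q by lra.
(* The trivial decoupling constant at level [Q], which covers every N < Q. *)
pose A : R := p%:R ^+ (2 * Q * s).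
have A1 : 1 <= A by rewrite exprn_ege1 // ler1n prime_gt0.
exists A => // N.
have [n] := ubnP N; elim: n N => // n IH N Nn.
have [NQ|QN] := ltnP N Q.
  apply: (decoupling_mono _ _ (@decoupling_trivial R k p N (prime_gt0 pp) k0)); first exact: prime_gt0.
  apply: (@le_trans _ _ A).
    by apply: ler_weXn2l; rewrite ?ler1n ?prime_gt0 // leq_mul // leq_mul // ltnW.
  rewrite ler_peMr //; last by rewrite powR_ge1.
  exact: le_trans ler01 A1.
move=> Om w f z c M NM adm.
have A0 : 0 < A by lra.
have BQ : (B <= Q)%N by rewrite leq_pmull // expn_gt0 k0.
have BN : (B <= N)%N := leq_trans BQ QN.
have N0 : (0 < N)%N := leq_trans B0 BN.
have decN N' : (N' < N)%N -> decoupling k p N' (A * q `^ N'%:R).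
  by move=> N'N; apply: IH; exact: leq_trans N'N Nn.
have bil : bilinear_bound k p N M w f c l0 1 B (2 * A * La ^+ r * q `^ (N%:R - g * B%:R)).
  apply: (bilinear_bound_iterate pp kp NM QN adm A0 La1 q1 decN dec_lower) => //.
  - by case/andP: l0k.
  - rewrite muln1; apply: (@leq_trans B); last by rewrite leq_pmull.
    apply: (@leq_trans (k`! ^ r)); last by rewrite leq_pmulr.
    apply: (@leq_trans k`!); last by rewrite expnS leq_pmulr // expn_gt0 fact_gt0.
    apply: (@leq_trans k); first by case/andP: l0k => _ /ltnW.
    by case: (k) k0 => // k' _; rewrite factS leq_pmulr // fact_gt0.
  - exact: dvdn_mulr.
have mu0 : 0 <= 2 * A * La ^+ r * q `^ (N%:R - g * B%:R).
  by rewrite !mulr_ge0 ?powR_ge0 ?exprn_ge0 //; lra.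
have D0 : 0 <= A * q `^ (N - 1)%:R by rewrite mulr_ge0 ?powR_ge0 //; lra.
have BN' : (0 < B <= N)%N by rewrite B0.
have decN1 : decoupling k p (N - 1) (A * q `^ (N - 1)%:R) by apply: decN; rewrite subn1 ltn_predL.
apply: (le_trans (broad_narrow_bound pp NM adm l0k BN' mu0 D0 decN1 bil)).
have c0 : forall J, 0 < c J by case: adm.
apply: ler_wpM2r; first by rewrite exprn_ge0 // ltW // gsum_gt0 // prime_gt0.
have qN : q `^ N%:R = q * q `^ (N - 1)%:R.
  by rewrite !powR_mulrn ?(ltW q0) // -exprS subn1 prednK.
have h1 : 4 ^+ s * (A * q `^ (N - 1)%:R) <= 2^-1 * (A * q `^ N%:R).
  rewrite qN mulrCA [leRHS]mulrCA ler_pM2l // mulrA ler_wpM2r ?powR_ge0 //.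
  lra.
have h2 : (4 * p%:R ^+ 2) ^+ s * p%:R ^+ (2 * B * s) * p%:R ^+ (B + 1) *
    (2 * A * La ^+ r * q `^ (N%:R - g * B%:R)) <= 2^-1 * (A * q `^ N%:R).
  have := iteration_constant p4 C1 e0 B0 CB dQ eg; rewrite -/La -/q.
  move/(ler_wpM2r (powR_ge0 q (N%:R - g * B%:R))).
  rewrite -[X in _ <= X -> _]mulrA -powRD ?(gt_eqF q0) ?implybT // subrKC.
  move/(ler_wpM2l (ltW A0)); rewrite [X in _ <= X -> _]mulrCA => /(le_trans _); apply.
  by rewrite le_eqVlt; apply/orP; left; apply/eqP; ring.
by apply: (le_trans (lerD h1 h2)); rewrite -mulrDl; lra.
Qed.

Lemma decoupling_epsilon_loss k : (0 < k)%N -> epsilon_loss k.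
Proof.
elim/ltn_ind: k => k IH k0.
have [k1|k1] := ltnP 1 k.
  by apply: epsilon_loss_step => // l /andP [l0 lk]; apply: IH.
have -> : k = 1%N by lia.
move=> eps e0; exists 0 => p pp _; exists 1 => // N.
apply: (decoupling_mono _ _ (@decoupling1 R p N pp)); first exact: prime_gt0.
by rewrite mul1r !powR_ge1 ?ler1n ?prime_gt0 // ltW.
Qed.

End Bound.

(** * Vinogradov sums over a finite torus *)

Section ExponentialSum.
Variable R : realType.
Local Notation C := (R[i]).

Lemma exists_prim_root (n : nat) : (0 < n)%N -> exists z : C, n.-primitive_root z.
Proof.
move=> n0; have [r Dp] := closed_field_poly_normal ('X^n - 1 : {poly C}).
rewrite (monicP _) ?monicXnsubC // scale1r in Dp.
have rn1 : all n.-unity_root r by apply/allP => z; rewrite -root_prod_XsubC -Dp.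
have sz_r : (n < (size r).+1)%N.
  by rewrite -(size_prod_XsubC r id) -Dp size_XnsubC.
have ur : uniq r by rewrite -separable_prod_XsubC -Dp separable_Xn_sub_1 // pnatr_eq0 -lt0n.
by have /hasP [z _ pz] := has_prim_root n0 rn1 ur sz_r; exists z.
Qed.

Variables (k m q' : nat) (z : C).
Let q := q'.+1.
Hypothesis pz : q.-primitive_root z.
Local Notation Om := {ffun 'I_k -> 'I_q'.+1}.

(** The term e(alpha_1 x + ... + alpha_k x ^ k) at the rational point with alpha_j proportional to
    o_j / q. It is 0 outside 1, ..., m, so that sums may run up to a power of p. *)
Definition vino_phase (x : nat) (o : Om) : C :=
  (0 < x <= m)%N%:R * \prod_(j < k) z ^+ (o j * x ^ j.+1).

Definition uniform_weight (o : Om) : R := (q ^ k)%N%:R^-1.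

(** Translating [o] by the coefficients of [g] modulo q multiplies the term x by z ^ (g(x) - g(0)),
    so every polynomial of degree at most k is realized exactly. *)
Lemma vino_phase_sym (g : {poly int}) : (size g <= k.+1)%N ->
  phase_sym uniform_weight vino_phase z g.
Proof.
move=> sg.
have zq : z ^+ q = 1 := prim_expr_order pz.
have z1 : sqn z = 1 by apply: sqn_unity zq.
have z0 : z != 0 by rewrite -sqn_eq0 z1 oner_neq0.
pose a : Om := [ffun j : 'I_k => inZp `|(g`_j.+1 %% q%:Z)%Z|].
exists (perm (@addIr _ a)), (z ^ (- g`_0)); split=> // [|x o]; first exact: sqn_exprz.
rewrite permE /vino_phase (horner_coef_wide _ sg) big_ord_recl expr0 mulr1.
rewrite -expfzDr // addrA addNr add0r [RHS]mulrCA; congr (_ * _).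
have -> : z ^ (\sum_(j < k) g`_(lift ord0 j) * x%:Z ^+ lift ord0 j) =
    \prod_(j < k) z ^ (g`_j.+1 * x%:Z ^+ j.+1).
  have zD : {morph (fun t : int => z ^ t) : u v / u + v >-> u * v}.
    by move=> u v; rewrite expfzDr.
  by rewrite (big_morph _ zD (expr0z z)); apply: eq_bigr => j _; rewrite lift0.
rewrite -big_split /=; apply: eq_bigr => j _.
have e : z ^+ ((o + a)%R j) = z ^ g`_j.+1 * z ^+ o j.
  rewrite !ffunE /= (prim_expr_mod pz) exprD mulrC (prim_expr_mod pz); congr (_ * _).
  rewrite exprnP gez0_abs ?modz_ge0 //.
  apply: (exprz_congr z0 zq); exists (- (g`_j.+1 %/ q%:Z)%Z).
  by rewrite {2}(divz_eq g`_j.+1 q%:Z); ring.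
by rewrite exprM e exprMn -exprM -Posz_exp -exprz_exp -exprnP.
Qed.

Lemma sqn_vino_phase x o : sqn (vino_phase x o) <= 1.
Proof.
have z1 : sqn z = 1 by apply: sqn_unity (prim_expr_order pz).
rewrite /vino_phase sqnM.
have -> : sqn (\prod_(j < k) z ^+ (o j * x ^ j.+1)) = 1.
  elim/big_ind: _ => [|u v hu hv|j _]; first exact: sqn1.
    by rewrite sqnM hu hv mulr1.
  by rewrite sqnX z1 expr1n.
by case: (_ && _); rewrite mulr1 ?sqn1 // /sqn [normc _]normc0 expr0n.
Qed.

(** The sum is q or 0. This positivity allows pairs outside a given set of solutions to be
    dropped. *)
Lemma geometric_unity_ge0 (y : C) : y ^+ q = 1 -> 0 <= \sum_(t < q) y ^+ t.
Proof.
move=> yq; have [->|y1] := eqVneq y 1.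
  by apply: sumr_ge0 => t _; rewrite expr1n ler01.
have : (y - 1) * \sum_(t < q) y ^+ t = 0 by rewrite -subrX1 yq subrr.
by move/eqP; rewrite mulf_eq0 subr_eq0 (negPf y1) => /eqP ->.
Qed.

(* Averaging over o counts the solutions of the system modulo q, whence only an
   upper bound. *)
Lemma vino_count (s : nat) (T : {set {ffun 'I_s -> 'I_m.+1} * {ffun 'I_s -> 'I_m.+1}}) :
  (forall h, h \in T -> (forall i, (0 < h.1 i)%N && (0 < h.2 i)%N) /\
     forall j : 'I_k, (\sum_i h.1 i ^ j.+1 = \sum_i h.2 i ^ j.+1)%N) ->
  #|T|%:R <= \sum_o uniform_weight o * sqn (\sum_(x < m.+1) vino_phase x o) ^+ s.
Proof.
move=> HT; have z1 : sqn z = 1 by apply: sqn_unity (prim_expr_order pz).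
rewrite -lecR rmorph_sum /=.
pose pr (h : {ffun 'I_s -> 'I_m.+1}) o := \prod_i vino_phase (h i) o.
have E o : (uniform_weight o * sqn (\sum_(x < m.+1) vino_phase x o) ^+ s)%:C%C =
   \sum_h \sum_h' ((q ^ k)%N%:R^-1 : R)%:C%C * (pr h o * (pr h' o)^*%C).
  have FE : (\sum_(x < m.+1) vino_phase x o) ^+ s = \sum_h pr h o.
    by rewrite -(bigA_distr_bigA (fun (_ : 'I_s) (x : 'I_m.+1) => vino_phase x o)) prodr_const card_ord.
  rewrite rmorphM rmorphXn /= sqn_conj exprMn -rmorphXn /= FE rmorph_sum mulr_suml mulr_sumr.
  by apply: eq_bigr => h _; rewrite /= !mulr_sumr.
rewrite (eq_bigr _ (fun o _ => E o)).
rewrite exchange_big /=.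
under eq_bigr do rewrite exchange_big /=.
rewrite pair_big /=.
pose A (h : {ffun 'I_s -> 'I_m.+1}) (j : 'I_k) := (\sum_i h i ^ j.+1)%N.
have prE h o : pr h o = [forall i, 0 < h i]%N%:R * \prod_(j < k) (z ^+ A h j) ^+ o j.
  rewrite /pr /vino_phase big_split /= exchange_big /=; congr (_ * _).
    case: forallP => [h0|/forallP]; last rewrite negb_forall => /existsP [i hi].
      by rewrite big1 // => i _; rewrite h0 -ltnS ltn_ord.
    by rewrite (bigD1 i) //= (negPf hi) mul0r.
  apply: eq_bigr => j _; rewrite /A -exprM mulnC big_distrr /=.
  by rewrite (big_morph _ (exprD z) (expr0 z)).
(* The average over [o] factors into k geometric sums, one for each equation of the system. *)
have S (h h' : {ffun 'I_s -> 'I_m.+1}) :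
  \sum_o ((q ^ k)%N%:R^-1 : R)%:C%C * (pr h o * (pr h' o)^*%C) =
  ((q ^ k)%N%:R^-1 : R)%:C%C * (([forall i, 0 < h i] && [forall i, 0 < h' i])%N%:R *
   \prod_(j < k) \sum_(t < q) (z ^+ A h j * (z ^+ A h' j)^*%C) ^+ t).
  rewrite -mulr_sumr; congr (_ * _).
  rewrite bigA_distr_bigA mulr_sumr /=.
  apply: eq_bigr => o _; rewrite !prE rmorphM /= mulrACA; congr (_ * _).
    by rewrite rmorph_nat -natrM mulnb.
  by rewrite rmorph_prod -big_split /=; apply: eq_bigr => j _; rewrite rmorphXn exprMn.
have S0 h h' : 0 <= \sum_o ((q ^ k)%N%:R^-1 : R)%:C%C * (pr h o * (pr h' o)^*%C).
  rewrite S mulr_ge0 ?lecR ?invr_ge0 ?ler0n // mulr_ge0 ?ler0n //.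
  apply: prodr_ge0 => j _; apply: geometric_unity_ge0.
  by rewrite exprMn -rmorphXn -!exprM !(mulnC _ q) !exprM (prim_expr_order pz) !expr1n rmorph1 mulr1.
apply: (@le_trans _ _ (\sum_(h in T) \sum_o ((q ^ k)%N%:R^-1 : R)%:C%C * (pr h.1 o * (pr h.2 o)^*%C))).
  rewrite -sumr_const rmorph_sum /=; apply: ler_sum => h hT.
  have [h0 hA] := HT h hT; rewrite S.
  have -> : [forall i, 0 < h.1 i]%N by apply/forallP => i; case/andP: (h0 i).
  have -> : [forall i, 0 < h.2 i]%N by apply/forallP => i; case/andP: (h0 i).
  rewrite mul1r (eq_bigr (fun _ => q%:R)) => [|j _]; last first.
    rewrite (_ : A h.2 j = A h.1 j) ?/A ?hA // -sqn_conj sqnX z1 expr1n.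
    by under eq_bigr do rewrite expr1n; rewrite sumr_const card_ord.
  rewrite prodr_const card_ord -natrX -(rmorph_nat (real_complex R)) -rmorphM /= mulVf //.
  by rewrite pnatr_eq0 expn_eq0.
rewrite [leRHS](bigID (fun h => h \in T)) /=.
by apply: ler_wpDr => //; apply: sumr_ge0 => h _; exact: S0.
Qed.

End ExponentialSum.

(** With M = N the pieces are single terms, of modulus at most 1, and the weight has total mass 1;
    hence the bounds [c J] = 1. *)
Lemma vino_phase_admissible (R : realType) (k p m N q' : nat) (z : R[i]) :
  q'.+1 = (p ^ (k * N))%N -> q'.+1.-primitive_root z ->
  admissible k p N N (@uniform_weight R k q') (vino_phase m z) z (fun=> 1).
Proof.
move=> qE pz; have sumw : \sum_(o : {ffun 'I_k -> 'I_q'.+1}) uniform_weight R o = 1.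
  by rewrite sumr_const card_ffun !card_ord -[LHS]mulr_natl mulfV.
split; first by rewrite -qE.
- by move=> o; rewrite invr_ge0.
- move=> xi j jk; exists 0; rewrite mulr0 addr0; apply: vino_phase_sym => //.
  by rewrite size_exp_XsubC ltnS.
- by move=> _; exact: ltr01.
move=> J _; rewrite expr1n -[leRHS]sumw; apply: ler_sum => o _.
rewrite gsum_id ler_piMr ?invr_ge0 // exprn_ile1 ?sqn_ge0 //.
exact: sqn_vino_phase.
Qed.

(** * The mean value estimate *)

Lemma J_bound (R : realType) (k : nat) (eps : R) : (0 < k)%N -> 0 < eps ->
  exists2 C : R, 0 <= C & forall X : R, 1 <= X ->
    (J (tri k) k X)%:R <= C * X `^ ((tri k)%:R + eps).
Proof.
move=> k0 e0; have [p0 Hp] := decoupling_epsilon_loss k0 e0.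
have [p p0p pp] := prime_above p0.
have [C C1 dec] := Hp p pp (ltnW p0p).
have Cge0 : 0 <= C by lra.
exists (C * p%:R `^ ((tri k)%:R + eps)) => [|X X1]; first by rewrite mulr_ge0 ?powR_ge0.
pose m := Num.truncn X.
have X0 : 0 <= X by lra.
have mX : m%:R <= X by rewrite truncn_le.
have m0 : (0 < m)%N by rewrite truncn_gt0.
(* The least N with m < p ^ N, so that p ^ N <= p X, where p is fixed independently of X. *)
pose N := (trunc_log p m).+1.
have /andP [pm mp] := trunc_log_bounds (prime_gt1 pp) m0.
have q0 : (0 < p ^ (k * N))%N by rewrite expn_gt0 prime_gt0.
have [z pz] := exists_prim_root R q0.
pose q' := (p ^ (k * N)).-1.
have qE : q'.+1 = (p ^ (k * N))%N by rewrite prednK.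
rewrite -qE in pz.
have adm := vino_phase_admissible m qE pz.
have := dec N _ _ _ _ _ _ (leqnn N) adm.
have -> : gsum p N 0 0 (fun=> 1) = (p ^ N)%:R :> R.
  by rewrite /gsum subn0 sumr_const card_ord.
have fE (o : {ffun 'I_k -> 'I_q'.+1}) :
    gsum p N 0 0 ((vino_phase m z)^~ o) = \sum_(x < m.+1) vino_phase m z x o.
  rewrite /gsum subn0 (big_ord_widen _ (fun x => vino_phase m z x o) mp) [RHS]big_mkcond /=.
  apply: eq_bigr => x _; rewrite add0n expn0 mul1n; case: ltnP => // mx.
  by rewrite /vino_phase [(x <= m)%N]leqNgt mx andbF mul0r.
under eq_bigr do rewrite fE.
move=> H; apply: le_trans (le_trans _ H) _.
  apply: (vino_count pz) => h; rewrite inE => /and3P [/forallP r1 /forallP r2 /forallP sys].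
  split=> [i|j]; last by apply/eqP.
  by case/andP: (r1 i) => -> _; case/andP: (r2 i) => -> _.
have P0 : 0 <= p%:R :> R by [].
have pNX : (p ^ N)%:R <= p%:R * X.
  by rewrite expnS natrM ler_wpM2l // (le_trans _ mX) // ler_nat.
rewrite -!mulrA ler_wpM2l // -powRM //.
have -> : (p%:R `^ eps) `^ N%:R = (p ^ N)%:R `^ eps.
  by rewrite natrX -(powR_mulrn N P0) -[LHS]powRrM -[RHS]powRrM (mulrC eps).
rewrite -powR_mulrn // -powRD; last first.
  by rewrite (gt_eqF (_ : 0 < (p ^ N)%:R)) ?implybT // ltr0n expn_gt0 prime_gt0.
rewrite addrC ge0_ler_powR ?nnegrE ?mulr_ge0 // addr_ge0 // ltW //.
Qed.

Theorem theorem1p5 (R : realType) :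
  exists Delta : nat -> R,
    (exists eta : nat -> R,
        (eta k @[k --> \oo] --> (0 : R)) /\
        \forall k \near \oo, Delta k = (1 / 3 + eta k) * k%:R) /\
    (\forall k \near \oo, forall eps : R, 0 < eps ->
       exists C : R, \forall X \near +oo,
         (J (k * (k + 1))./2 k X)%:R
           <= C * X `^ (k%:R * (k%:R + 1) / 2 + Delta k + eps)).
Proof.
exists (fun k => 1 / 3 * k%:R); split.
  exists (fun=> 0); split; first exact: cvg_cst.
  by near=> k; rewrite addr0.
near=> k => eps e0.
have k0 : (0 < k)%N by near: k; exact: nbhs_infty_gt.
have [C C0 HC] := J_bound k0 e0.
have tE : (k * (k + 1))./2 = tri k by rewrite addn1 -tri_double mul2n doubleK.
have tR : k%:R * (k%:R + 1) / 2 = (tri k)%:R :> R.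
  by rewrite natr1 -natrM -tri_double natrM mulrAC divff ?mul1r // pnatr_eq0.
exists C; near=> X.
have X1 : 1 <= X by near: X; exact: nbhs_pinfty_ge.
rewrite tE tR; apply: (le_trans (HC X X1)); apply: ler_wpM2l => //.
(* Since X >= 1 and k / 3 >= 0, adding k / 3 to the exponent only weakens the bound. *)
by apply: ler_powR => //; rewrite lerD2r lerDl mulr_ge0 // divr_ge0.
Unshelve. all: by end_near.
Qed.
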